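(* Let $d=3$, fix the grid (with mesh size $h>0$) and $\alpha\in[-1,2)$, and for $0<\delta\le h$ let $$\rho_\delta(|\boldsymbol s|)=C^\alpha_{3,\delta}\,|\boldsymbol s|^{-3-\alpha},\qquad C^\alpha_{3,\delta}=\frac{3(2-\alpha)}{2\pi}\,\delta^{\alpha-2}.$$ Then the corresponding nonlocal stiffness matrices $\boldsymbol S_\delta$ satisfy $$\lim_{\delta\to0^+}\boldsymbol S_\delta=\boldsymbol S_{x_3}\otimes\boldsymbol M_{x_2}\otimes\boldsymbol M_{x_1}+\boldsymbol M_{x_3}\otimes\boldsymbol S_{x_2}\otimes\boldsymbol M_{x_1}+\boldsymbol M_{x_3}\otimes\boldsymbol M_{x_2}\otimes\boldsymbol S_{x_1},$$ where, for $j=1,2,3$, $\boldsymbol S_{x_j}=\frac1h\,\mathrm{tridiag}(-1,2,-1)$ and $\boldsymbol M_{x_j}=\frac h6\,\mathrm{tridiag}(1,4,1)$ are the usual $N_j\times N_j$ tridiagonal FEM stiffness and mass matrices in one dimension.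
   Context: Domain and grid: $\Omega=\prod_{j=1}^3(a_j,b_j)$ and $\widetilde\Omega=\prod_{j=1}^3(a_j-\delta,b_j+\delta)$. For $j=1,2,3$, $N_j\ge1$ is an integer and $h=(b_j-a_j)/(N_j+1)$ is the same for all $j$. Grid points are $\xi_{j,n_j}=a_j+n_jh$, $0\le n_j\le N_j+1$. Basis: for $1\le n_j\le N_j$, $\phi_{n_j}(x_j)$ is the hat function equal to $(x_j-\xi_{j,n_j-1})/h$ on $(\xi_{j,n_j-1},\xi_{j,n_j})$, equal to $(\xi_{j,n_j+1}-x_j)/h$ on $(\xi_{j,n_j},\xi_{j,n_j+1})$ (value $1$ at $\xi_{j,n_j}$), and zero elsewhere (extended by zero to all of $\mathbb{R}$). Bilinear form ($\mathbb{B}^3_\delta$ is the ball of radius $\delta$ centered at $0$): $$\mathcal{A}_\delta(u,v)=\frac12\int_{\widetilde\Omega}\int_{\mathbb{B}^3_\delta}(u(\boldsymbol x+\boldsymbol s)-u(\boldsymbol x))(v(\boldsymbol x+\boldsymbol s)-v(\boldsymbol x))\rho_\delta(|\boldsymbol s|)\,\mathrm{d}\boldsymbol s\,\mathrm{d}\boldsymbol x.$$ The stiffness matrix $\boldsymbol S_\delta\in\mathbb{R}^{N_1N_2N_3\times N_1N_2N_3}$ has entries $(\boldsymbol S_\delta)_{ll'}=\mathcal{A}_\delta(\phi_{n_1}\phi_{n_2}\phi_{n_3},\phi_{m_1}\phi_{m_2}\phi_{m_3})$ with $l=(n_3-1)N_1N_2+(n_2-1)N_1+n_1$, $l'=(m_3-1)N_1N_2+(m_2-1)N_1+m_1$.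 $\mathrm{tridiag}(a,b,a)$ denotes the tridiagonal matrix with diagonal entries $b$ and off-diagonal entries $a$; the limit of matrices is entrywise. *)

(* Defs.v *)
From HB Require Import structures.
From mathcomp Require Import all_boot all_order all_algebra.
From mathcomp Require Import all_classical all_reals all_analysis.
From mathcomp Require Import mxtens.

Set Implicit Arguments.
Unset Strict Implicit.
Unset Printing Implicit Defensive.

Import Order.TTheory GRing.Theory Num.Theory.
Import numFieldNormedType.Exports.

Local Open Scope classical_set_scope.
Local Open Scope ring_scope.

(* A point (x1, x2, x3) of R^3 is ((x1, x2), x3) : R * R * R. *)

Lemma product_sigma_finite (R : realType) d1 d2 (T1 : measurableType d1)
    (T2 : measurableType d2) (m1 : {sigma_finite_measure set T1 -> \bar R})
    (m2 : {sigma_finite_measure set T2 -> \bar R}) :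
  sigma_finite setT (m1 \x m2)%E.
Proof.
have /sigma_finiteP[F [TF ndF Foo]] := sigma_finiteT m1.
have /sigma_finiteP[G [TG ndG Goo]] := sigma_finiteT m2.
exists (fun n => F n `*` G n).
  rewrite -setXTT TF TG predeqE => -[x y]; split.
    move=> [/= [n _ Fnx] [k _ Gky]]; exists (maxn n k) => //; split.
    - by move: x Fnx; exact/subsetPset/ndF/leq_maxl.
    - by move: y Gky; exact/subsetPset/ndG/leq_maxr.
  by move=> [n _ []/= ? ?]; split; exists n.
move=> k; have [? ?] := Foo k; have [? ?] := Goo k.
split; first exact: measurableX.
by rewrite product_measure1E// lte_mul_pinfty// ge0_fin_numE.
Qed.

Definition lebesgue2 (R : realType) :
    set (measurableTypeR R * measurableTypeR R) -> \bar R :=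
  (@lebesgue_measure R \x @lebesgue_measure R)%E.

HB.instance Definition _ (R : realType) := Measure.on (@lebesgue2 R).
HB.instance Definition _ (R : realType) :=
  Measure_isSigmaFinite.Build _ _ _ (@lebesgue2 R)
    (product_sigma_finite (@lebesgue_measure R) (@lebesgue_measure R)).

Definition lebesgue3 (R : realType) :
    set (measurableTypeR R * measurableTypeR R * measurableTypeR R) ->
    \bar R :=
  (@lebesgue2 R \x @lebesgue_measure R)%E.

HB.instance Definition _ (R : realType) := Measure.on (@lebesgue3 R).
HB.instance Definition _ (R : realType) :=
  Measure_isSigmaFinite.Build _ _ _ (@lebesgue3 R)
    (product_sigma_finite (@lebesgue2 R) (@lebesgue_measure R)).

(* The library's norm on R * R * R is the maximum norm. *)
Definition enorm3 (R : realType) (s : R * R * R) : R :=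
  Num.sqrt (s.1.1 ^+ 2 + s.1.2 ^+ 2 + s.2 ^+ 2).

Definition eball3 (R : realType) (delta : R) : set (R * R * R) :=
  [set s | enorm3 s < delta].

Definition enlarged_box (R : realType) (a1 a2 a3 b1 b2 b3 delta : R) :
    set (R * R * R) :=
  `]a1 - delta, b1 + delta[ `*` `]a2 - delta, b2 + delta[
    `*` `]a3 - delta, b3 + delta[.

Definition nonlocal_form (R : realType) (D : set (R * R * R)) (delta : R)
    (rho : R -> R) (u v : R * R * R -> R) : R :=
  2^-1 * \int[@lebesgue3 R]_(x in D) \int[@lebesgue3 R]_(s in eball3 delta)
    ((u (x + s) - u x) * (v (x + s) - v x) * rho (enorm3 s)).

Definition grid_point (R : realType) (a h : R) (n : nat) : R := a + n%:R * h.

Definition hat (R : realType) (a h : R) (n : nat) (x : R) : R :=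
  if grid_point a h n.-1 < x <= grid_point a h n then
    (x - grid_point a h n.-1) / h
  else if grid_point a h n < x < grid_point a h n.+1 then
    (grid_point a h n.+1 - x) / h
  else 0.

Definition hat3 (R : realType) (a1 a2 a3 h : R) (n1 n2 n3 : nat)
    (x : R * R * R) : R :=
  hat a1 h n1 x.1.1 * hat a2 h n2 x.1.2 * hat a3 h n3 x.2.

(* Row and column numbers are counted from 0: l stands for the triple with
   l = (n3 - 1) * N1 * N2 + (n2 - 1) * N1 + (n1 - 1), see [basis_fun_lex]. *)
Definition basis_fun (R : realType) (a1 a2 a3 h : R) (N1 N2 : nat) (l : nat) :
    R * R * R -> R :=
  hat3 a1 a2 a3 h (l %% N1).+1 ((l %/ N1) %% N2).+1 (l %/ (N1 * N2)).+1.

Lemma basis_fun_lex (R : realType) (a1 a2 a3 h : R) (N1 N2 n1 n2 n3 : nat) :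
  (0 < n1 <= N1)%N -> (0 < n2 <= N2)%N -> (0 < n3)%N ->
  basis_fun a1 a2 a3 h N1 N2
    ((n3 - 1) * (N1 * N2) + (n2 - 1) * N1 + (n1 - 1))%N
  = hat3 a1 a2 a3 h n1 n2 n3.
Proof.
case: n1 => // n1; case: n2 => // n2; case: n3 => // n3 /=.
move=> lt1 lt2 _; rewrite /basis_fun !subn1 /=.
have N1gt0 : (0 < N1)%N by exact: leq_ltn_trans lt1.
have N2gt0 : (0 < N2)%N by exact: leq_ltn_trans lt2.
rewrite [in (N1 * N2)%N]mulnC mulnA -mulnDl.
rewrite modnMDl modn_small // divnMDl // (divn_small lt1) addn0.
rewrite modnMDl modn_small //.
by rewrite [(N2 * N1)%N]mulnC divnMA divnMDl // (divn_small lt1) addn0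
  divnMDl // (divn_small lt2) addn0.
Qed.

(* The size is written N3 * N2 * N1 to agree with the type of A *t B *t C. *)
Definition nonlocal_stiffness (R : realType) (a1 a2 a3 b1 b2 b3 h : R)
    (N1 N2 N3 : nat) (delta : R) (rho : R -> R) : 'M[R]_(N3 * N2 * N1) :=
  \matrix_(l, l')
    nonlocal_form (enlarged_box a1 a2 a3 b1 b2 b3 delta) delta rho
      (basis_fun a1 a2 a3 h N1 N2 l) (basis_fun a1 a2 a3 h N1 N2 l').

Definition kernel_const (R : realType) (alpha delta : R) : R :=
  3 * (2 - alpha) / (2 * pi) * delta `^ (alpha - 2).

Definition frac_kernel (R : realType) (alpha delta r : R) : R :=
  kernel_const alpha delta * r `^ (- 3 - alpha).

Definition tridiag (R : realType) (n : nat) (lo d up : R) : 'M[R]_n :=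
  \matrix_(i, j)
    if i == j then d
    else if i == j.+1 :> nat then lo
    else if j == i.+1 :> nat then up
    else 0.

Definition fem_stiffness (R : realType) (h : R) (n : nat) : 'M[R]_n :=
  h^-1 *: tridiag n (-1) 2 (-1).

Definition fem_mass (R : realType) (h : R) (n : nat) : 'M[R]_n :=
  (h / 6) *: tridiag n 1 4 1.

Notation "A *t B" := (tensmx A B)
  (at level 40, left associativity, format "A  *t  B") : ring_scope.

(* Main.v *)
Require Import Defs.
From HB Require Import structures.
From mathcomp Require Import all_boot all_order all_algebra.
From mathcomp Require Import all_classical all_reals all_analysis.
From mathcomp Require Import measurable_realfun mxtens ring lra.

Set Implicit Arguments.
Unset Strict Implicit.
Unset Printing Implicit Defensive.

Import Order.TTheory GRing.Theory Num.Theory.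
Import numFieldNormedType.Exports.

Local Open Scope classical_set_scope.
Local Open Scope ring_scope.

(** The kernel concentrates at 0 and is normalised so that its second moments
    over the ball B of radius delta are exactly those of the local problem:
    the integral of s_i s_j rho(|s|) over B is 2 if i = j and 0 otherwise,
    whatever delta is.  Hence, for linear functions with slopes g and k, the
    inner integral of the nonlocal form is exactly 2 g.k
    ([kernel_bilinear]).

    Let u and v be two basis functions.  At a point x off the grid planes they
    are locally products of affine functions, so that their increments differ
    from the differentials by O(|s|^2), and the inner integral at x is
    2 grad u(x).grad v(x) + O(delta) ([increment_density_approx]).  The Lipschitz
    bound on u and v, with the second moment of the kernel, bounds the inner
    integral uniformly in x and delta ([increment_density_bound]).  The grid
    planes form a null set and the enlarged boxes stay in a bounded box, so
    dominated convergence gives the integral of grad u.grad v over R^3 as the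
    limit ([nonlocal_form_cvg]).  By Fubini this integral splits into three
    products of one-dimensional mass and stiffness integrals
    ([integral_grad_density]), which are the entries of the Kronecker products.

    The moments are computed without polar coordinates.  Slicing a ball into
    discs gives the integral of z^2 over a ball ([integral_ball_sqr]); the layer
    cake formula, which writes a negative power of |s| as an integral of
    indicators of balls, then gives the integral of z^2 |s|^q
    ([integral_ball_powR]).  The other second moments follow by permuting
    coordinates, and the mixed ones vanish by reflection. *)

(** * Symmetries of the Lebesgue measure on R^3 *)

Section symmetries.
Context (R : realType).
Local Notation mu := (@lebesgue_measure R).
Local Notation T3 := (measurableTypeR R * measurableTypeR R * measurableTypeR R)%type.

Implicit Type f : T3 -> \bar R.
Local Open Scope ereal_scope.

Lemma measurable_coord1 : measurable_fun [set: T3] (fun s => s.1.1).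
Proof. by apply: (measurableT_comp measurable_fst); exact: measurable_fst. Qed.

Lemma measurable_coord2 : measurable_fun [set: T3] (fun s => s.1.2).
Proof. by apply: (measurableT_comp measurable_snd); exact: measurable_fst. Qed.

Lemma measurable_coord3 : measurable_fun [set: T3] snd.
Proof. exact: measurable_snd. Qed.

(** Tonelli twice; the permutations of coordinates reduce to exchanging two
    consecutive iterated integrals. *)
Lemma ge0_integral3E f : measurable_fun setT f -> (forall s, 0 <= f s) ->
  \int[@lebesgue3 R]_s f s = \int[mu]_x \int[mu]_y \int[mu]_z f ((x, y), z).
Proof.
move=> mf f0.
rewrite (fubini_tonelli1 (m1 := @lebesgue2 R) (m2 := mu))//.
rewrite (fubini_tonelli1 (m1 := mu) (m2 := mu))//.
- exact: measurable_fun_fubini_tonelli_F.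
- by move=> xy; exact: integral_ge0.
Qed.

Lemma ge0_integral3_swap12 f : measurable_fun setT f -> (forall s, 0 <= f s) ->
  \int[@lebesgue3 R]_s f ((s.1.2, s.1.1), s.2) = \int[@lebesgue3 R]_s f s.
Proof.
move=> mf f0.
have mt : measurable_fun [set: T3] (fun s : T3 => ((s.1.2, s.1.1), s.2) : T3).
  apply: measurable_fun_pair; last exact: measurable_coord3.
  by apply: measurable_fun_pair; [exact: measurable_coord2|exact: measurable_coord1].
rewrite (ge0_integral3E mf f0) (ge0_integral3E (measurableT_comp mf mt) (fun s => f0 _)) /=.
rewrite [RHS](fubini_tonelli (m1 := mu) (m2 := mu)
  (fun xy => \int[mu]_z f (xy, z)))//.
- exact: measurable_fun_fubini_tonelli_F.
- by move=> xy; exact: integral_ge0.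
Qed.

Lemma ge0_integral3_swap23 f : measurable_fun setT f -> (forall s, 0 <= f s) ->
  \int[@lebesgue3 R]_s f ((s.1.1, s.2), s.1.2) = \int[@lebesgue3 R]_s f s.
Proof.
move=> mf f0.
have mt : measurable_fun [set: T3] (fun s : T3 => ((s.1.1, s.2), s.1.2) : T3).
  apply: measurable_fun_pair; last exact: measurable_coord2.
  by apply: measurable_fun_pair; [exact: measurable_coord1|exact: measurable_coord3].
rewrite (ge0_integral3E mf f0) (ge0_integral3E (measurableT_comp mf mt) (fun s => f0 _)) /=.
apply: eq_integral => x _ /=.
rewrite [RHS](fubini_tonelli (m1 := mu) (m2 := mu)
  (fun yz => f ((x, yz.1), yz.2)))//.
apply: measurableT_comp => //.
apply: measurable_fun_pair; last exact: measurable_snd.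
by apply: measurable_fun_pair; [exact: measurable_cst|exact: measurable_fst].
Qed.

Lemma ge0_integral_opp (g : measurableTypeR R -> \bar R) : measurable_fun setT g ->
  (forall x, 0 <= g x) -> \int[mu]_x g (- x)%R = \int[mu]_x g x.
Proof.
move=> mg g0.
transitivity (\int[pushforward mu (-%R : _ -> measurableTypeR R)]_x g x).
  by rewrite ge0_integral_pushforward.
by apply: eq_measure_integral => //= A mA _; exact: lebesgue_measureN.
Qed.

Lemma ge0_integral3_opp3 f : measurable_fun setT f -> (forall s, 0 <= f s) ->
  \int[@lebesgue3 R]_s f (s.1, - s.2)%R = \int[@lebesgue3 R]_s f s.
Proof.
move=> mf f0.
have mt : measurable_fun [set: T3] (fun s : T3 => (s.1, - s.2)%R : T3).
  by apply: measurable_fun_pair => //; apply: measurableT_comp.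
rewrite (ge0_integral3E mf f0) (ge0_integral3E (measurableT_comp mf mt) (fun s => f0 _)) /=.
apply: eq_integral => x _; apply: eq_integral => y _ /=.
rewrite (ge0_integral_opp (g := fun z => f (x, y, z)))//.
by apply: measurableT_comp.
Qed.
End symmetries.

(** * One-dimensional primitives and the area of a disc *)

Section areas.
Context (R : realType).
Local Notation mu := (@lebesgue_measure R).
Local Notation T2 := (measurableTypeR R * measurableTypeR R)%type.

(** For a primitive differentiable up to the endpoints, the one-sided
    continuity conditions of [continuous_FTC2] hold automatically. *)
Lemma FTC_primitive (f F : R -> R) a b : a < b ->
  (forall x, a <= x <= b -> {for x, continuous f}) ->
  (forall x, a <= x <= b -> is_derive x 1 F (f x)) ->
  (\int[mu]_(x in `[a, b]) (f x)%:E = (F b - F a)%:E)%E.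
Proof.
move=> ab cf dF.
have cF x : a <= x <= b -> {for x, continuous F}.
  by move=> /dF[dFx _]; apply: differentiable_continuous; exact/derivable1_diffP.
rewrite EFinB; apply: continuous_FTC2 => //.
- by apply: continuous_in_subspaceT => x /set_mem /=; rewrite in_itv/=; exact: cf.
- split => [x| |].
  + by rewrite in_itv/= => /andP[/ltW ax /ltW xb]; have [|] := dF x; rewrite ?ax.
  + by apply: cvg_at_right_filter; apply: cF; rewrite lexx ltW.
  + by apply: cvg_at_left_filter; apply: cF; rewrite lexx ltW.
- move=> x; rewrite in_itv/= => /andP[/ltW ax /ltW xb].
  by rewrite derive1E; apply: derive_val; apply: dF; rewrite ax.
Qed.

Lemma sqr_lt_itv (k : R) :
  [set y : R | y ^+ 2 < k] = `]- Num.sqrt k, Num.sqrt k[%classic.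
Proof.
apply/seteqP; split => y /=; rewrite in_itv/= -ltr_norml -sqrtr_sqr.
  by move=> yk; rewrite ltr_sqrt// (le_lt_trans _ yk)// sqr_ge0.
have [k0|k0] := lerP k 0.
  by rewrite (ler0_sqrtr k0) ltNge sqrtr_ge0.
by rewrite ltr_sqrt.
Qed.

(** Substituting x = r sin t turns the integrand into 2 r^2 cos^2 t, with
    primitive r^2 (t + sin t cos t). *)
Lemma integral_semicircle (r : R) : 0 < r ->
  (\int[mu]_(x in `[(- r)%R, r]) (2 * Num.sqrt (r ^+ 2 - x ^+ 2))%:E
   = (pi * r ^+ 2)%:E)%E.
Proof.
move=> r0.
pose F (t : R) := r * sin t.
have dF (t : R) : is_derive t 1 F (r * cos t).
  by apply: is_derive_eq; rewrite /GRing.scale/=; ring.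
have F'E : derive1 F = (fun t => r * cos t).
  by apply/funext => t; rewrite derive1E; apply: derive_val.
have cF (t : R) : {for t, continuous F}.
  by apply: differentiable_continuous; apply/derivable1_diffP; case: (dF t).
have cF' (t : R) : {for t, continuous (fun t => r * cos t)}.
  by apply: cvgM; [exact: cvg_cst|exact: continuous_cos].
have pi0 := pi_gt0 R.
have Fl : F (- (pi / 2)) = - r by rewrite /F sinN sin_pihalf mulrN1.
have Fr : F (pi / 2) = r by rewrite /F sin_pihalf mulr1.
rewrite -[in `[_, _]]Fl -[X in `[_, X]]Fr.
rewrite (integration_by_substitution_increasing (F := F)
  (G := fun x => 2 * Num.sqrt (r ^+ 2 - x ^+ 2))); first last.
- apply: continuous_subspaceT => x; apply: cvgM; first exact: cvg_cst.
  apply: continuous_comp; last exact: sqrt_continuous.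
  by apply: cvgB; [exact: cvg_cst|exact: exprn_continuous].
- split => [t _| |].
  + by case: (dF t).
  + exact/cvg_at_right_filter/cF.
  + exact/cvg_at_left_filter/cF.
- by rewrite F'E; apply/cvg_ex; exists (r * cos (pi / 2)); apply/cvg_at_left_filter/cF'.
- by rewrite F'E; apply/cvg_ex; exists (r * cos (- (pi / 2))); apply/cvg_at_right_filter/cF'.
- by rewrite F'E => t _; exact: cF'.
- move=> t s ht hs ts; rewrite /F ltr_pM2l//.
  by rewrite ltr_sin.
- by lra.
pose G (t : R) := r ^+ 2 * (t + sin t * cos t).
have dG (t : R) : is_derive t 1 G (2 * r ^+ 2 * cos t ^+ 2).
  apply: is_derive_eq; rewrite /GRing.scale/=.
  have := cos2Dsin2 t; rewrite !expr2 => h; nra.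
transitivity (\int[mu]_(x in `[(- (pi / 2))%R, (pi / 2)%R]) (2 * r ^+ 2 * cos x ^+ 2)%:E)%E.
  apply: eq_integral => t /set_mem/=; rewrite in_itv/= => ht.
  congr EFin; rewrite F'E !fctE /= /F.
  have -> : r ^+ 2 - (r * sin t) ^+ 2 = (r * cos t) ^+ 2.
    by rewrite !exprMn sin2cos2; ring.
  have c0 : 0 <= cos t by apply: cos_ge0_pihalf.
  by rewrite sqrtr_sqr ger0_norm ?mulr_ge0 ?(ltW r0)//; ring.
rewrite (FTC_primitive (F := G)) //; last first.
- move=> x _; apply: cvgM; first exact: cvg_cst.
  apply: (@continuous_comp _ _ _ (@cos R) (fun y => y ^+ 2)).
    exact: continuous_cos.
  exact: exprn_continuous.
- by lra.
by rewrite /G sinN cosN sin_pihalf cos_pihalf; congr EFin; field.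
Qed.

Local Open Scope ereal_scope.

Lemma measurable_sqr2 : measurable_fun [set: T2] (fun p => p.1 ^+ 2 + p.2 ^+ 2)%R.
Proof.
by apply: measurable_funD; apply: measurable_funX; [exact: measurable_fst|exact: measurable_snd].
Qed.

(** The section at abscissa x is the interval of half-length sqrt (r^2 - x^2),
    which is empty for |x| > r because the square root is then 0. *)
Lemma integral_disc (r : R) : (0 < r)%R ->
  \int[@lebesgue2 R]_p (\1_[set p : T2 | p.1 ^+ 2 + p.2 ^+ 2 < r ^+ 2] p)%:E
  = (pi * r ^+ 2)%:E.
Proof.
move=> r0.
set D := [set _ | _].
have mD : measurable D.
  rewrite (_ : D = (fun p => p.1 ^+ 2 + p.2 ^+ 2)%R @^-1` `]-oo, (r ^+ 2)%R[%classic).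
    by rewrite -[X in measurable X]setTI; exact: measurable_sqr2.
  by apply/seteqP; split => p /=; rewrite in_itv/=.
rewrite (fubini_tonelli1 (m1 := mu) (m2 := mu)) //; last first.
  by apply/measurable_EFinP; exact: measurable_indic.
rewrite -integral_semicircle// [RHS]integral_mkcond.
apply: eq_integral => x _; rewrite /fubini_F.
transitivity (\int[mu]_y (\1_[set y : R | y ^+ 2 < r ^+ 2 - x ^+ 2] y)%:E).
  apply: eq_integral => y _; rewrite !indicE; congr ((nat_of_bool _)%:R%:E).
  by apply/idP/idP => /set_mem; rewrite /D/= => h; apply/mem_set => /=; lra.
rewrite sqr_lt_itv integral_indic ?setIT//= lebesgue_measure_itv/= lte_fin patchE.
have [k0|k0] := lerP (r ^+ 2 - x ^+ 2)%R 0%R.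
  rewrite (ler0_sqrtr k0) oppr0 ltxx mulr0; by case: ifP.
rewrite ifT; last by rewrite gtrN// sqrtr_gt0.
rewrite ifT.
  by rewrite -EFinB; congr EFin; ring.
apply/mem_set => /=; rewrite in_itv/= -ler_norml -(@ler_pXn2r _ 2)// ?nnegrE ?ltW//.
by rewrite real_normK ?num_real//; lra.
Qed.

End areas.

(** * Radial moments of Euclidean balls *)

Section radial_moments.
Context (R : realType).
Local Notation mu := (@lebesgue_measure R).
Local Notation T3 := (measurableTypeR R * measurableTypeR R * measurableTypeR R)%type.
Implicit Types (s : T3) (t q : R).

Lemma is_derive_powR_primitive (e x : R) : e != 0 -> 0 < x ->
  is_derive x 1 (fun t => t `^ e / e) (x `^ (e - 1)).
Proof.
move=> e0 x0; have dp := is_derive1_powR e x0.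
rewrite (_ : (fun _ => _) = e^-1 \*: ((@powR R) ^~ e)); last first.
  by apply/funext => t /=; rewrite /GRing.scale/= mulrC.
by apply: is_derive_eq; rewrite /GRing.scale/= mulrA mulVf// mul1r.
Qed.

Lemma continuous_powR (e x : R) : 0 < x -> {for x, continuous ((@powR R)^~ e)}.
Proof.
move=> x0; apply: differentiable_continuous; apply/derivable1_diffP.
by apply: derivable_powR; rewrite in_itv/= x0.
Qed.

Lemma integral_powR_segment (e a b : R) : e != 0 -> 0 < a -> a < b ->
  (\int[mu]_(t in `[a, b]) (t `^ (e - 1))%:E = (b `^ e / e - a `^ e / e)%:E)%E.
Proof.
move=> e0 a0 ab; apply: (FTC_primitive (F := fun t => t `^ e / e)) => // x /andP[ax _].
  by apply: continuous_powR; exact: lt_le_trans ax.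
by apply: is_derive_powR_primitive => //; exact: lt_le_trans ax.
Qed.

(** The integrand may be unbounded at 0, so the integral is the limit over the
    segments from b/(n+2) to b. *)
Lemma integral_powR_0 (e b : R) : 0 < e -> 0 < b ->
  (\int[mu]_(t in `]0%R, b]) (t `^ (e - 1))%:E = (b `^ e / e)%:E)%E.
Proof.
move=> e0 b0.
pose a n : R := b * harmonic n.+1.
have a0 n : 0 < a n by rewrite mulr_gt0// harmonic_gt0.
have ab n : a n < b.
  by rewrite /a/= -[ltRHS]mulr1 ltr_pM2l// invf_lt1// ltr1n.
pose F n : set (measurableTypeR R) := `[a n, b]%classic.
have acvg : a n @[n --> \oo] --> 0.
  rewrite -[X in _ --> X](mulr0 b); apply: cvgMr.
  have := @cvg_harmonic R; by rewrite -(cvg_shiftS (harmonic : nat -> R)).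
have UF : \bigcup_n F n = `]0, b]%classic.
  apply/seteqP; split => x /=.
    by move=> [n _]; rewrite /F/= !in_itv/= => /andP[anx ->]; rewrite (lt_le_trans _ anx).
  rewrite in_itv/= => /andP[x0 xb].
  have [n _ /(_ _ (leqnn _)) hn] := cvgr_lt _ acvg _ x0.
  by exists n => //; rewrite /F/= in_itv/= xb ltW.
have cvgF := ge0_nondecreasing_set_cvg_integral (F := F) (mu := mu)
  (f := fun t => (t `^ (e - 1))%:E).
rewrite -UF; apply: (cvg_unique _ (cvgF _ _ _ _)) => //.
- move=> m n mn; apply/subsetPset => x; rewrite /F/= !in_itv/= => /andP[amx ->].
  rewrite andbT (le_trans _ amx)// ler_pM2l// lef_pV2 ?posrE ?ltr0n// ler_nat.
  by rewrite !ltnS.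
- by move=> n; exact: measurable_itv.
- move=> n; apply/measurable_EFinP; apply: measurable_funTS; exact: measurable_powR.
- by move=> n x _; rewrite lee_fin powR_ge0.
rewrite (_ : (fun _ => _) = (fun n => (b `^ e / e - a n `^ e / e)%:E)); last first.
  by apply/funext => n; rewrite /F integral_powR_segment ?gt_eqF.
apply: cvg_EFin; first exact: nearW.
rewrite -[X in _ --> X]subr0; apply: cvgB; first exact: cvg_cst.
rewrite -(mul0r e^-1); apply: cvgMl.
exact: ((cvg_at_rightP _ _ _).1 (powR_cvg0 e0) a (conj a0 acvg)).
Qed.

Lemma enorm3_ge0 (s : R * R * R) : 0 <= enorm3 s. Proof. exact: sqrtr_ge0. Qed.

Lemma sqr_enorm3 (s : R * R * R) :
  enorm3 s ^+ 2 = s.1.1 ^+ 2 + s.1.2 ^+ 2 + s.2 ^+ 2.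
Proof. by rewrite sqr_sqrtr// !addr_ge0// sqr_ge0. Qed.

Lemma enorm3_lt (s : R * R * R) t : 0 < t ->
  (enorm3 s < t) = (s.1.1 ^+ 2 + s.1.2 ^+ 2 + s.2 ^+ 2 < t ^+ 2).
Proof.
by move=> t0; rewrite -sqr_enorm3 ltr_pXn2r// nnegrE ?enorm3_ge0// ltW.
Qed.

Lemma measurable_enorm3 : measurable_fun [set: T3] (@enorm3 R).
Proof.
apply: (measurableT_comp (f := @Num.sqrt R)).
  by apply: continuous_measurable_fun; exact: sqrt_continuous.
apply: measurable_funD; last by apply: measurable_funX; exact: measurable_coord3.
by apply: measurable_funD; apply: measurable_funX;
  [exact: measurable_coord1|exact: measurable_coord2].
Qed.

Lemma measurable_eball3 t : measurable (eball3 t : set T3).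
Proof.
rewrite (_ : eball3 t = @enorm3 R @^-1` `]-oo, t[%classic).
  by rewrite -[X in measurable X]setTI; exact: measurable_enorm3.
by apply/seteqP; split => s /=; rewrite /eball3/= in_itv.
Qed.

Local Open Scope ereal_scope.

(** The section at height z is a disc of squared radius t^2 - z^2, so the
    integral is that of pi z^2 (t^2 - z^2) over the segment from -t to t. *)
Lemma integral_ball_sqr t : (0 < t)%R ->
  \int[@lebesgue3 R]_s (s.2 ^+ 2 * \1_(eball3 t : set T3) s)%:E
  = (4 / 15 * pi * t ^+ 5)%:E.
Proof.
move=> t0.
have mI : measurable_fun [set: T3] (\1_(eball3 t : set T3) : T3 -> R).
  by apply: measurable_indic; exact: measurable_eball3.
have mf : measurable_fun [set: T3] (fun s => s.2 ^+ 2 * \1_(eball3 t : set T3) s)%R.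
  by apply: measurable_funM => //; apply: measurable_funX; exact: measurable_coord3.
rewrite (fubini_tonelli2 (m1 := @lebesgue2 R) (m2 := mu)) //; first last.
- by move=> s; rewrite lee_fin mulr_ge0// sqr_ge0.
- exact/measurable_EFinP.
transitivity (\int[mu]_(z in `[(- t)%R, t]) (pi * (t ^+ 2 * z ^+ 2 - z ^+ 4))%:E).
  rewrite [RHS]integral_mkcond; apply: eq_integral => z _; rewrite /fubini_G patchE.
  under eq_integral do rewrite /= EFinM.
  rewrite ge0_integralZl_EFin ?sqr_ge0//; first last.
  - apply/measurable_EFinP; apply: (measurableT_comp mI).
    by apply: measurable_fun_pair => //; exact: measurable_cst.
  have [zt|zt] := ltP `|z|%R t; last first.
    rewrite integral0_eq ?mule0; last first.
      move=> p _; rewrite indicE memNset// /eball3/= => /(le_lt_trans _).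
      have ze : (`|z| <= enorm3 (p, z))%R.
        rewrite -(@ler_pXn2r _ 2)// ?nnegrE ?enorm3_ge0// real_normK ?num_real//.
        by rewrite sqr_enorm3/= lerDr addr_ge0 ?sqr_ge0.
      by move=> /(_ _ ze); rewrite ltNge zt.
    case: ifP => // /set_mem/=; rewrite in_itv/= -ler_norml => zt'.
    have <- : (`|z| = t)%R by apply/eqP; rewrite eq_le zt zt'.
    by rewrite real_normK ?num_real//; congr EFin; ring.
  rewrite mem_set; last by rewrite /= in_itv/= -ler_norml ltW.
  have tz : (0 < t ^+ 2 - z ^+ 2)%R.
    rewrite subr_gt0 -(real_normK (num_real z)) ltr_pXn2r// nnegrE//; exact: ltW.
  transitivity ((z ^+ 2)%:E * (pi * Num.sqrt (t ^+ 2 - z ^+ 2) ^+ 2)%:E); last first.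
    by rewrite sqr_sqrtr ?ltW// -EFinM; congr EFin; ring.
  rewrite -integral_disc ?sqrtr_gt0//; congr (_ * _).
  apply: eq_integral => p _; rewrite !indicE; congr ((nat_of_bool _)%:R%:E).
  apply/idP/idP => /set_mem; rewrite /eball3/= ?enorm3_lt// ?sqr_sqrtr ?(ltW tz)//= => h;
    apply/mem_set; rewrite /eball3/= ?enorm3_lt ?sqr_sqrtr ?(ltW tz)//=; lra.
pose F z : R := (pi * (t ^+ 2 * z ^+ 3 / 3 - z ^+ 5 / 5))%R.
have dF (x : R) : is_derive x 1%R F (pi * (t ^+ 2 * x ^+ 2 - x ^+ 4))%R.
  by apply: is_derive_eq; rewrite /GRing.scale/=; field.
rewrite (FTC_primitive (F := F)) //.
- by congr EFin; rewrite /F; field.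
- by rewrite (lt_trans _ t0)// oppr_lt0.
- move=> x _; apply: cvgM; first exact: cvg_cst.
  apply: cvgB; last exact: exprn_continuous.
  by apply: cvgM; [exact: cvg_cst|exact: exprn_continuous].
Qed.

(** Layer cake: for 0 < |s| < t, |s|^q equals t^q plus the integral of (- q)
    u^(q - 1) over |s| < u < t. Exchanging the integrals leaves the integrals
    of z^2 over the balls of radius u. The factor z^2 makes the origin
    harmless. *)
Lemma integral_ball_powR q t : (- 5 < q)%R -> (q < 0)%R -> (0 < t)%R ->
  \int[@lebesgue3 R]_(s in (eball3 t : set T3)) (s.2 ^+ 2 * enorm3 s `^ q)%:E
  = (4 * pi / (3 * (q + 5)) * t `^ (q + 5))%:E.
Proof.
move=> q5 q0 t0; have qN : (0 <= - q)%R by rewrite oppr_ge0 ltW.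
pose A : set (T3 * measurableTypeR R) := [set p | (enorm3 p.1 < p.2)%R /\ (p.2 < t)%R].
pose g (p : T3 * measurableTypeR R) : R :=
  (p.1.2 ^+ 2 * (- q) * p.2 `^ (q - 1) * \1_A p)%R.
have g0 p : (0 <= (g p)%:E).
  by rewrite lee_fin; apply: mulr_ge0 => //; rewrite mulr_ge0 ?powR_ge0// mulr_ge0 ?sqr_ge0.
have mA : measurable A.
  rewrite (_ : A = ((fun p : T3 * measurableTypeR R => enorm3 p.1 - p.2)%R @^-1`
      `]-oo, 0%R[%classic) `&` (snd @^-1` `]-oo, t[%classic)).
    apply: measurableI; rewrite -[X in measurable X]setTI.
      apply: measurable_funB => //.
      by apply: (measurableT_comp measurable_enorm3); exact: measurable_fst.
    exact: measurable_snd.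
  by apply/seteqP; split => p; rewrite /A/= !in_itv/= subr_lt0.
have mg : measurable_fun [set: T3 * measurableTypeR R] (EFin \o g).
  apply/measurable_EFinP; apply: measurable_funM; last exact: measurable_indic.
  apply: measurable_funM; last first.
    by apply: (measurableT_comp (measurable_powR _)); exact: measurable_snd.
  apply: measurable_funM => //; apply: measurable_funX.
  by apply: (measurableT_comp (@measurable_coord3 R)); exact: measurable_fst.
(* Integrating over u first recovers the power of |s|, up to a constant. *)
have gs (s : T3) : \int[mu]_u (g (s, u))%:E =
    (s.2 ^+ 2 * (enorm3 s `^ q - t `^ q) * \1_(eball3 t : set T3) s)%:E.
  have [st|ts] := ltP (enorm3 s) t; last first.
    rewrite integral0_eq; last first.
      move=> u _; rewrite /g indicE memNset ?mulr0// /A/= => -[su ut].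
      by move: (lt_trans su ut); rewrite ltNge ts.
    by rewrite indicE memNset ?mulr0// /eball3/= ltNge ts.
  rewrite indicE mem_set// mulr1.
  have [s0|s0] := leP (enorm3 s) 0%R.
    have s20 : (s.2 ^+ 2 = 0)%R.
      have : (enorm3 s ^+ 2 = 0)%R.
        by rewrite (_ : enorm3 s = 0%R) ?expr0n//; apply/eqP; rewrite eq_le s0 enorm3_ge0.
      rewrite sqr_enorm3 => h.
      by move: h (sqr_ge0 s.1.1) (sqr_ge0 s.1.2) (sqr_ge0 s.2); lra.
    rewrite s20 mul0r; apply: integral0_eq => u _.
    by rewrite /g/= s20 !mul0r.
  transitivity (\int[mu]_(u in `]enorm3 s, t[) ((s.2 ^+ 2 * - q)%:E * (u `^ (q - 1))%:E)).
    rewrite [RHS]integral_mkcond; apply: eq_integral => u _.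
    rewrite /g indicE patchE/= -EFinM.
    have -> : ((s, u) \in A) = (u \in `]enorm3 s, t[%classic).
      by apply/idP/idP => /set_mem h; apply/mem_set; move: h; rewrite /A/= in_itv/= => /andP.
    by case: ifP; rewrite ?mulr1 ?mulr0.
  have mp : measurable_fun [set: measurableTypeR R] (fun u => (u `^ (q - 1))%:E).
    by apply/measurable_EFinP; exact: measurable_powR.
  rewrite ge0_integralZl_EFin//; first last.
  - by rewrite mulr_ge0 ?sqr_ge0// oppr_ge0 ltW.
  - exact: measurable_funTS.
  - by move=> u _; rewrite lee_fin powR_ge0.
  rewrite -(integral_itv_bndoo true false); last exact: measurable_funTS.
  rewrite integral_powR_segment ?lt_eqF// -EFinM; congr EFin.
  by have := ltr0_neq0 q0; move=> qn0; field.
(* Integrating over s first leaves a power of u on the interval from 0 to t. *)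
have gu (u : measurableTypeR R) : \int[@lebesgue3 R]_s (g (s, u))%:E =
    ((fun u => (- q * (4 / 15 * pi))%:E * (u `^ (q + 5 - 1))%:E) \_ `]0%R, t[) u.
  rewrite patchE; case: ifPn => [/set_mem|].
    rewrite /= in_itv/= => /andP[u0 ut].
    have k0 : (0 <= - q * u `^ (q - 1))%R by rewrite mulr_ge0 ?powR_ge0// oppr_ge0 ltW.
    transitivity (\int[@lebesgue3 R]_s
        ((- q * u `^ (q - 1))%:E * (s.2 ^+ 2 * \1_(eball3 u : set T3) s)%:E)).
      apply: eq_integral => s _; rewrite -EFinM /g !indicE.
      have -> : ((s, u) \in A) = (s \in (eball3 u : set T3)).
        apply/idP/idP => /set_mem h; apply/mem_set; first by case: h.
        by split.
      by congr EFin => /=; ring.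
    rewrite ge0_integralZl_EFin ?integral_ball_sqr//; first last.
    - apply/measurable_EFinP; apply: measurable_funM.
        by apply: measurable_funX; exact: measurable_coord3.
      by apply: measurable_indic; exact: measurable_eball3.
    - by move=> s _; rewrite lee_fin mulr_ge0 ?sqr_ge0.
    rewrite -!EFinM; congr EFin.
    have -> : (q + 5 - 1 = (q - 1) + 5%:R)%R by ring.
    rewrite (@powRD _ u (q - 1) 5%:R) ?(gt_eqF u0) ?implybT// powR_mulrn ?ltW//; ring.
  move/negP => uN; apply: integral0_eq => s _.
  rewrite /g indicE memNset ?mulr0// /A/= => -[su ut]; apply: uN; apply/mem_set.
  by rewrite /= in_itv/= ut (le_lt_trans (enorm3_ge0 s) su).
have mI : measurable_fun [set: T3] (fun s => s.2 ^+ 2 * \1_(eball3 t : set T3) s)%R.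
  apply: measurable_funM; first by apply: measurable_funX; exact: measurable_coord3.
  by apply: measurable_indic; exact: measurable_eball3.
transitivity (\int[@lebesgue3 R]_s
    ((t `^ q)%:E * (s.2 ^+ 2 * \1_(eball3 t : set T3) s)%:E + \int[mu]_u (g (s, u))%:E)).
  rewrite integral_mkcond; apply: eq_integral => s _.
  rewrite gs -EFinM -EFinD patchE indicE.
  by case: ifP => _; congr EFin; rewrite /=; ring.
have mF := measurable_fun_fubini_tonelli_F (m2 := mu) _ mg g0.
rewrite ge0_integralD//; first last.
- by move=> s _; exact: integral_ge0.
- by apply: measurable_funeM; exact/measurable_EFinP.
- by move=> s _; rewrite -EFinM lee_fin; apply: mulr_ge0; rewrite ?powR_ge0// mulr_ge0 ?sqr_ge0.
rewrite ge0_integralZl_EFin ?powR_ge0 ?integral_ball_sqr//; first last.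
- exact/measurable_EFinP.
- by move=> s _; rewrite lee_fin mulr_ge0 ?sqr_ge0.
rewrite (fubini_tonelli (m1 := @lebesgue3 R) (m2 := mu) (EFin \o g))//.
under eq_integral do rewrite /= gu.
rewrite -integral_mkcond/=.
have mp : measurable_fun [set: measurableTypeR R] (fun u => (u `^ (q + 5 - 1))%:E).
  by apply/measurable_EFinP; exact: measurable_powR.
rewrite ge0_integralZl_EFin//; first last.
- by rewrite mulr_ge0 ?oppr_ge0 ?ltW// mulr_gt0 ?pi_gt0.
- exact: measurable_funTS.
- by move=> u _; rewrite lee_fin powR_ge0.
rewrite -(integral_itv_bndoo false false); last exact: measurable_funTS.
rewrite integral_powR_0//; last by lra.
rewrite -!EFinM -EFinD; congr EFin.
rewrite (@powRD _ t q 5%:R) ?(gt_eqF t0) ?implybT// powR_mulrn ?ltW//.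
have q50 : (q + 5 != 0)%R by rewrite gt_eqF//; lra.
by field.
Qed.

End radial_moments.

(** * Second moments of the kernel *)

Section second_moments.
Context (R : realType).
Local Notation T3 := (measurableTypeR R * measurableTypeR R * measurableTypeR R)%type.
Implicit Types (s : T3) (f : T3 -> \bar R).

(** Measure preservation is only asked on nonnegative functions, where it
    follows from Tonelli; odd functions are treated through their positive and
    negative parts. *)
Definition symmetry3 (tau : T3 -> T3) : Prop :=
  [/\ measurable_fun setT tau, forall s, enorm3 (tau s) = enorm3 s &
    forall f, measurable_fun setT f -> (forall s, 0 <= f s)%E ->
      (\int[@lebesgue3 R]_s f (tau s) = \int[@lebesgue3 R]_s f s)%E].

Definition swap12 s : T3 := ((s.1.2, s.1.1), s.2).
Definition swap23 s : T3 := ((s.1.1, s.2), s.1.2).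
Definition opp2 s : T3 := ((s.1.1, - s.1.2), s.2).
Definition opp3 s : T3 := (s.1, - s.2).

Lemma symmetry3_swap12 : symmetry3 swap12.
Proof.
split; last exact: ge0_integral3_swap12.
  apply: measurable_fun_pair; last exact: measurable_coord3.
  by apply: measurable_fun_pair; [exact: measurable_coord2|exact: measurable_coord1].
by move=> s; rewrite /enorm3/= [X in X + _]addrC.
Qed.

Lemma symmetry3_swap23 : symmetry3 swap23.
Proof.
split; last exact: ge0_integral3_swap23.
  apply: measurable_fun_pair; last exact: measurable_coord2.
  by apply: measurable_fun_pair; [exact: measurable_coord1|exact: measurable_coord3].
by move=> s; rewrite /enorm3/= addrAC.
Qed.

Lemma symmetry3_opp3 : symmetry3 opp3.
Proof.
split; last exact: ge0_integral3_opp3.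
  by apply: measurable_fun_pair => //; apply: measurableT_comp.
by move=> s; rewrite /enorm3/= sqrrN.
Qed.

Lemma symmetry3_comp tau sigma :
  symmetry3 tau -> symmetry3 sigma -> symmetry3 (tau \o sigma).
Proof.
move=> [mt nt it] [ms ns is_]; split; first exact: measurableT_comp.
  by move=> s /=; rewrite nt ns.
move=> f mf f0 /=.
rewrite -(it f mf f0); apply: (is_ (f \o tau)) => [|s]; last exact: f0.
exact: (measurableT_comp mf mt).
Qed.

Lemma symmetry3_opp2 : symmetry3 opp2.
Proof.
rewrite (_ : opp2 = swap23 \o (opp3 \o swap23)); last first.
  by apply/funext => s.
apply: symmetry3_comp; first exact: symmetry3_swap23.
by apply: symmetry3_comp; [exact: symmetry3_opp3|exact: symmetry3_swap23].
Qed.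

Local Open Scope ereal_scope.

Lemma ge0_integral_ball_symmetry tau (t : R) f : symmetry3 tau ->
  measurable_fun setT f -> (forall s, 0 <= f s) ->
  \int[@lebesgue3 R]_(s in (eball3 t : set T3)) f (tau s)
  = \int[@lebesgue3 R]_(s in (eball3 t : set T3)) f s.
Proof.
move=> [mt nt it] mf f0.
rewrite integral_mkcond [RHS]integral_mkcond -(it (f \_ (eball3 t : set T3))).
- apply: eq_integral => s _; rewrite !patchE.
  have -> // : (tau s \in (eball3 t : set T3)) = (s \in (eball3 t : set T3)).
  by apply/idP/idP => /set_mem h; apply/mem_set; move: h; rewrite /eball3/= nt.
- by apply/(measurable_restrictT f (measurable_eball3 t)); exact: measurable_funTS.
- by move=> s; apply: erestrict_ge0 => //.
Qed.

(** The reflection exchanges the positive and negative parts of g, which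
    therefore have the same integral. *)
Lemma integral_ball_odd tau (t : R) (g : T3 -> R) : symmetry3 tau ->
  (@lebesgue3 R).-integrable (eball3 t : set T3) (EFin \o g) ->
  measurable_fun setT g -> (forall s, g (tau s) = - g s)%R ->
  (\int[@lebesgue3 R]_(s in (eball3 t : set T3)) (g s)%R = 0)%R.
Proof.
move=> st ig mg gt; rewrite /Rintegral integralE.
have mg' : measurable_fun [set: T3] (EFin \o g) by exact/measurable_EFinP.
have fin : \int[@lebesgue3 R]_(s in (eball3 t : set T3)) (EFin \o g)^\- s \is a fin_num.
  by apply: integrable_neg_fin_num => //; exact: measurable_eball3.
rewrite -(ge0_integral_ball_symmetry t st (measurable_funepos mg'))//.
have -> : (fun s => (EFin \o g)^\+ (tau s)) = (EFin \o g)^\-.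
  by apply/funext => s; rewrite funeposE funenegE/= gt.
by rewrite subee.
Qed.

End second_moments.

Section kernel_moments.
Context (R : realType) (alpha delta : R).
Hypotheses (alpha_ge : -1 <= alpha) (alpha_lt : alpha < 2) (delta_gt0 : 0 < delta).
Local Notation T3 := (measurableTypeR R * measurableTypeR R * measurableTypeR R)%type.
Local Notation rho s := (frac_kernel alpha delta (enorm3 s)).
Local Notation B := (eball3 delta : set T3).
Implicit Types (s : T3).

Lemma kernel_const_ge0 : 0 <= kernel_const alpha delta.
Proof.
rewrite /kernel_const mulr_ge0 ?powR_ge0// divr_ge0 ?mulr_ge0 ?pi_ge0//.
by rewrite subr_ge0 ltW.
Qed.

Lemma frac_kernel_ge0 r : 0 <= frac_kernel alpha delta r.
Proof. by rewrite /frac_kernel mulr_ge0 ?powR_ge0 ?kernel_const_ge0. Qed.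

Lemma measurable_frac_kernel : measurable_fun [set: T3] (fun s => rho s).
Proof.
apply: measurable_funM => //.
apply: (measurableT_comp (measurable_powR _)); exact: measurable_enorm3.
Qed.

Local Open Scope ereal_scope.

(** The exponent q = - 3 - alpha lies in (-5, -2], and the normalising
    constant of the kernel cancels the value given by [integral_ball_powR]. *)
Lemma kernel_moment33 : \int[@lebesgue3 R]_(s in B) (s.2 ^+ 2 * rho s)%:E = 2%:E.
Proof.
transitivity (\int[@lebesgue3 R]_(s in B)
   ((kernel_const alpha delta)%:E * (s.2 ^+ 2 * enorm3 s `^ (- 3 - alpha))%:E)).
  by apply: eq_integral => s _; rewrite -EFinM /frac_kernel; congr EFin; ring.
rewrite ge0_integralZl_EFin ?kernel_const_ge0//; first last.
- apply: measurable_funTS; apply/measurable_EFinP; apply: measurable_funM.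
    by apply: measurable_funX; exact: measurable_coord3.
  apply: (measurableT_comp (measurable_powR _)); exact: measurable_enorm3.
- by move=> s _; rewrite lee_fin; apply: mulr_ge0; rewrite ?sqr_ge0 ?powR_ge0.
- exact: measurable_eball3.
have qgt : (- 5 < - 3 - alpha)%R by move: alpha_lt; lra.
have qlt : (- 3 - alpha < 0)%R by move: alpha_ge; lra.
rewrite (integral_ball_powR qgt qlt delta_gt0).
rewrite -EFinM; congr EFin; rewrite /kernel_const.
have -> : (- 3 - alpha + 5 = - (alpha - 2))%R by ring.
rewrite powRN.
have a2 : (2 - alpha != 0)%R by rewrite gt_eqF// subr_gt0.
have a2' : (- (alpha - 2) != 0)%R by rewrite opprB.
have p0 : (delta `^ (alpha - 2) != 0)%R by rewrite gt_eqF// powR_gt0.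
have pi0 : (pi != 0 :> R)%R by rewrite gt_eqF// pi_gt0.
move: (@pi R) pi0 => P P0; field; rewrite p0 P0 andbT/=.
by rewrite -oppr_eq0.
Qed.

Lemma kernel_moment22 : \int[@lebesgue3 R]_(s in B) (s.1.2 ^+ 2 * rho s)%:E = 2%:E.
Proof.
rewrite -kernel_moment33.
rewrite -[RHS](ge0_integral_ball_symmetry delta (@symmetry3_swap23 R)); first last.
- by move=> s; rewrite lee_fin; apply: mulr_ge0; rewrite ?sqr_ge0 ?frac_kernel_ge0.
- apply/measurable_EFinP; apply: measurable_funM; last exact: measurable_frac_kernel.
  by apply: measurable_funX; exact: measurable_coord3.
apply: eq_integral => s _; have [_ -> _] := @symmetry3_swap23 R.
by [].
Qed.

Lemma kernel_moment11 : \int[@lebesgue3 R]_(s in B) (s.1.1 ^+ 2 * rho s)%:E = 2%:E.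
Proof.
rewrite -kernel_moment22.
rewrite -[RHS](ge0_integral_ball_symmetry delta (@symmetry3_swap12 R)); first last.
- by move=> s; rewrite lee_fin; apply: mulr_ge0; rewrite ?sqr_ge0 ?frac_kernel_ge0.
- apply/measurable_EFinP; apply: measurable_funM; last exact: measurable_frac_kernel.
  by apply: measurable_funX; exact: measurable_coord2.
apply: eq_integral => s _; have [_ -> _] := @symmetry3_swap12 R.
by [].
Qed.

(** The second moment of the kernel does not depend on delta; it controls
    every function bounded by a multiple of |s|^2. *)
Lemma kernel_moment : \int[@lebesgue3 R]_(s in B) (enorm3 s ^+ 2 * rho s)%:E = 6%:E.
Proof.
have mc (p : T3 -> R) : measurable_fun setT p ->
    measurable_fun B (fun s => (p s ^+ 2 * rho s)%:E).
  move=> mp; apply: measurable_funTS; apply/measurable_EFinP.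
  by apply: measurable_funM; [exact: measurable_funX|exact: measurable_frac_kernel].
have p0 (p : R) s : 0 <= (p ^+ 2 * rho s)%:E.
  by rewrite lee_fin; apply: mulr_ge0; rewrite ?sqr_ge0 ?frac_kernel_ge0.
have m1 := mc _ (@measurable_coord1 R); have m2 := mc _ (@measurable_coord2 R).
have m3 := mc _ (@measurable_coord3 R); have mB := measurable_eball3 delta.
under eq_integral do rewrite sqr_enorm3 !mulrDl !EFinD.
rewrite ge0_integralD//; first last.
- by apply: emeasurable_funD.
- by move=> s _; rewrite adde_ge0.
rewrite ge0_integralD// kernel_moment11 kernel_moment22 kernel_moment33 -!EFinD.
by congr EFin; ring.
Qed.

Lemma integrable_kernel (P : T3 -> R) (C : R) : measurable_fun setT P ->
  (forall s, B s -> `|P s| <= C * enorm3 s ^+ 2)%R ->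
  (@lebesgue3 R).-integrable B (fun s => (P s * rho s)%:E).
Proof.
move=> mP bP; have mB := measurable_eball3 delta.
apply: (@le_integrable _ _ _ _ _ _ _ (fun s => C%:E * (enorm3 s ^+ 2 * rho s)%:E)) => //.
- apply: measurable_funTS; apply/measurable_EFinP.
  by apply: measurable_funM => //; exact: measurable_frac_kernel.
- move=> s Bs; rewrite -EFinM/= lee_fin normrM (ger0_norm (frac_kernel_ge0 _)).
  apply: le_trans (ler_norm _); rewrite [leRHS]mulrA.
  by apply: ler_wpM2r; [exact: frac_kernel_ge0|exact: bP].
- apply: integrableZl => //; apply/integrableP; split.
    apply: measurable_funTS; apply/measurable_EFinP.
    apply: measurable_funM; last exact: measurable_frac_kernel.
    by apply: measurable_funX; exact: measurable_enorm3.
  rewrite (_ : \int[_]_(_ in _) _ = 6%:E) ?ltry// -kernel_moment.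
  apply: eq_integral => s _; rewrite gee0_abs// lee_fin; apply: mulr_ge0.
    exact: sqr_ge0.
  exact: frac_kernel_ge0.
Qed.

Lemma kernel_bound (P : T3 -> R) (C : R) : measurable_fun setT P ->
  (forall s, B s -> `|P s| <= C * enorm3 s ^+ 2)%R ->
  (`|\int[@lebesgue3 R]_(s in B) (P s * rho s)| <= 6 * C)%R.
Proof.
move=> mP bP; have mB := measurable_eball3 delta.
have iP := integrable_kernel mP bP.
have bC : (forall s, B s -> `|C * enorm3 s ^+ 2| <= `|C| * enorm3 s ^+ 2)%R.
  by move=> s _; rewrite normrM (ger0_norm (sqr_ge0 _)).
have mC : measurable_fun [set: T3] (fun s => C * enorm3 s ^+ 2)%R.
  by apply: measurable_funM => //; apply: measurable_funX; exact: measurable_enorm3.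
have iC := integrable_kernel mC bC.
apply: le_trans (le_normr_Rintegral mB iP) _.
have -> : (6 * C = \int[@lebesgue3 R]_(s in B) (C * enorm3 s ^+ 2 * rho s))%R.
  under eq_Rintegral do rewrite -mulrA.
  rewrite RintegralZl//.
    by rewrite /Rintegral kernel_moment/= mulrC.
  have mN : measurable_fun [set: T3] (fun s => enorm3 s ^+ 2)%R.
    by apply: measurable_funX; exact: measurable_enorm3.
  apply: (integrable_kernel (C := 1%R)) => // s _.
  by rewrite mul1r ger0_norm ?sqr_ge0.
apply: le_Rintegral => //.
- by apply: (@integrable_norm _ _ _ (@lebesgue3 R) B (fun s => P s * rho s)%R).
- move=> s Bs; rewrite normrM (ger0_norm (frac_kernel_ge0 _)).
  by apply: ler_wpM2r; [exact: frac_kernel_ge0|exact: bP].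
Qed.

End kernel_moments.

(** * The kernel as a quadratic form on increments *)

Section kernel_bilinear.
Context (R : realType) (alpha delta : R).
Hypotheses (alpha_ge : -1 <= alpha) (alpha_lt : alpha < 2) (delta_gt0 : 0 < delta).
Local Notation T3 := (measurableTypeR R * measurableTypeR R * measurableTypeR R)%type.
Local Notation rho s := (frac_kernel alpha delta (enorm3 s)).
Local Notation B := (eball3 delta : set T3).
Implicit Types (s : T3).

Definition dot3 (g s : R * R * R) : R := g.1.1 * s.1.1 + g.1.2 * s.1.2 + g.2 * s.2.

Lemma abs_coord_le (s : R * R * R) :
  [/\ `|s.1.1| <= enorm3 s, `|s.1.2| <= enorm3 s & `|s.2| <= enorm3 s].
Proof.
have sq x : x ^+ 2 <= s.1.1 ^+ 2 + s.1.2 ^+ 2 + s.2 ^+ 2 -> `|x| <= enorm3 s.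
  by move=> h; rewrite -(@ler_pXn2r _ 2)// ?nnegrE ?enorm3_ge0// sqr_enorm3 real_normK ?num_real.
by move: (sqr_ge0 s.1.1) (sqr_ge0 s.1.2) (sqr_ge0 s.2) => ? ? ?; split; apply: sq; lra.
Qed.

Let J (p : T3 -> R) := \int[@lebesgue3 R]_(s in B) (p s * rho s).
Let kint (p : T3 -> R) := (@lebesgue3 R).-integrable B (fun s => (p s * rho s)%:E).

(** Linear combinations of kernel integrals, with integrability carried along
    so that the quadratic form can be expanded term by term. *)
Let J_lin (a : R) p q : kint p -> kint q ->
  kint (fun s => a * p s + q s) /\ J (fun s => a * p s + q s) = a * J p + J q.
Proof.
move=> ip iq; have mB := measurable_eball3 delta.
have e : (fun s => (a * p s + q s) * rho s) = (fun s => a * (p s * rho s) + q s * rho s).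
  by apply/funext => s; ring.
have iap : (@lebesgue3 R).-integrable B (fun s => (a * (p s * rho s))%:E).
  under eq_fun do rewrite EFinM.
  exact: integrableZl.
split.
  rewrite /kint (_ : (fun _ => _) =
    (fun s => (a * (p s * rho s))%:E + (q s * rho s)%:E)%E); last first.
    by apply/funext => s; rewrite -EFinD; congr EFin; ring.
  exact: integrableD.
by rewrite /J e RintegralD// RintegralZl.
Qed.

Let kint_prod (p q : T3 -> R) : measurable_fun setT p -> measurable_fun setT q ->
  (forall s, `|p s| <= enorm3 s) -> (forall s, `|q s| <= enorm3 s) ->
  kint (fun s => p s * q s).
Proof.
move=> mp mq bp bq; apply: (integrable_kernel alpha_ge alpha_lt delta_gt0 (C := 1)).
  exact: measurable_funM.
by move=> s _; rewrite mul1r normrM expr2 ler_pM.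
Qed.

Let J_odd (tau : T3 -> T3) (p : T3 -> R) : symmetry3 tau -> kint p ->
  measurable_fun setT p -> (forall s, p (tau s) = - p s) -> J p = 0.
Proof.
move=> st ip mp pt; apply: (integral_ball_odd st ip).
  by apply: measurable_funM => //; exact: measurable_frac_kernel.
by move=> s; case: st => _ nt _; rewrite nt pt mulNr.
Qed.

(** Only the three diagonal second moments survive; the mixed ones are odd
    under a reflection. *)
Lemma kernel_bilinear (g k : R * R * R) :
  \int[@lebesgue3 R]_(s in B) (dot3 g s * dot3 k s * rho s)
  = 2 * (g.1.1 * k.1.1 + g.1.2 * k.1.2 + g.2 * k.2).
Proof.
have [m1 m2 m3] : [/\ measurable_fun [set: T3] (fun s => s.1.1 : R),
    measurable_fun [set: T3] (fun s => s.1.2 : R) &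
    measurable_fun [set: T3] (fun s => s.2 : R)].
  by split; [exact: measurable_coord1|exact: measurable_coord2|exact: measurable_coord3].
have b1 s : `|s.1.1| <= enorm3 s by case: (abs_coord_le s).
have b2 s : `|s.1.2| <= enorm3 s by case: (abs_coord_le s).
have b3 s : `|s.2| <= enorm3 s by case: (abs_coord_le s).
have i11 := kint_prod m1 m1 b1 b1; have i22 := kint_prod m2 m2 b2 b2.
have i33 := kint_prod m3 m3 b3 b3; have i12 := kint_prod m1 m2 b1 b2.
have i13 := kint_prod m1 m3 b1 b3; have i23 := kint_prod m2 m3 b2 b3.
have J11 : J (fun s => s.1.1 * s.1.1) = 2.
  by rewrite /J /Rintegral kernel_moment11.
have J22 : J (fun s => s.1.2 * s.1.2) = 2.
  by rewrite /J /Rintegral kernel_moment22.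
have J33 : J (fun s => s.2 * s.2) = 2.
  by rewrite /J /Rintegral kernel_moment33.
have J12 : J (fun s => s.1.1 * s.1.2) = 0.
  apply: (J_odd (@symmetry3_opp2 R)) => //; first exact: measurable_funM.
  by move=> s /=; rewrite mulrN.
have J13 : J (fun s => s.1.1 * s.2) = 0.
  apply: (J_odd (@symmetry3_opp3 R)) => //; first exact: measurable_funM.
  by move=> s /=; rewrite mulrN.
have J23 : J (fun s => s.1.2 * s.2) = 0.
  apply: (J_odd (@symmetry3_opp3 R)) => //; first exact: measurable_funM.
  by move=> s /=; rewrite mulrN.
(* The first square starts the sum with coefficient 1, hence the - 1. *)
have [i1 e1] := J_lin (g.1.1 * k.1.1 - 1) i11 i11.
have [i2 e2] := J_lin (g.1.2 * k.1.2) i22 i1.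
have [i3 e3] := J_lin (g.2 * k.2) i33 i2.
have [i4 e4] := J_lin (g.1.1 * k.1.2 + g.1.2 * k.1.1) i12 i3.
have [i5 e5] := J_lin (g.1.1 * k.2 + g.2 * k.1.1) i13 i4.
have [i6 e6] := J_lin (g.1.2 * k.2 + g.2 * k.1.2) i23 i5.
transitivity (J (fun s => (g.1.2 * k.2 + g.2 * k.1.2) * (s.1.2 * s.2)
  + ((g.1.1 * k.2 + g.2 * k.1.1) * (s.1.1 * s.2)
  + ((g.1.1 * k.1.2 + g.1.2 * k.1.1) * (s.1.1 * s.1.2)
  + (g.2 * k.2 * (s.2 * s.2) + (g.1.2 * k.1.2 * (s.1.2 * s.1.2)
  + ((g.1.1 * k.1.1 - 1) * (s.1.1 * s.1.1) + s.1.1 * s.1.1))))))).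
  by rewrite /J; apply: eq_Rintegral => s _; rewrite /dot3; ring.
by rewrite e6 e5 e4 e3 e2 e1 J11 J22 J33 J12 J13 J23; ring.
Qed.

(** U V - (g.s)(k.s) = U (V - k.s) + (U - g.s)(k.s) is at most 2 L M |s|^3 <=
    2 L M delta |s|^2, and the second moment of the kernel is 6. *)
Lemma kernel_bilinear_approx (U V : T3 -> R) (g k : R * R * R) (L M : R) :
  0 <= L -> 0 <= M -> measurable_fun setT U -> measurable_fun setT V ->
  (forall s, `|U s| <= L * enorm3 s) -> (forall s, `|dot3 k s| <= L * enorm3 s) ->
  (forall s, B s -> `|U s - dot3 g s| <= M * enorm3 s ^+ 2) ->
  (forall s, B s -> `|V s - dot3 k s| <= M * enorm3 s ^+ 2) ->
  (forall s, `|V s| <= L * enorm3 s) -> (forall s, `|dot3 g s| <= L * enorm3 s) ->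
  `|\int[@lebesgue3 R]_(s in B) (U s * V s * rho s)
    - 2 * (g.1.1 * k.1.1 + g.1.2 * k.1.2 + g.2 * k.2)| <= 12 * L * M * delta.
Proof.
move=> L0 M0 mU mV bU bk dU dV bV bg; have mB := measurable_eball3 delta.
have [m1 m2 m3] : [/\ measurable_fun [set: T3] (fun s => s.1.1 : R),
    measurable_fun [set: T3] (fun s => s.1.2 : R) &
    measurable_fun [set: T3] (fun s => s.2 : R)].
  by split; [exact: measurable_coord1|exact: measurable_coord2|exact: measurable_coord3].
have mdot (c : R * R * R) : measurable_fun [set: T3] (dot3 c).
  apply: measurable_funD; last by apply: measurable_funM => //; exact: measurable_cst.
  by apply: measurable_funD; apply: measurable_funM => //; exact: measurable_cst.
have bound2 (p q : T3 -> R) : (forall s, `|p s| <= L * enorm3 s) ->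
    (forall s, `|q s| <= L * enorm3 s) ->
    forall s, B s -> `|p s * q s| <= L ^+ 2 * enorm3 s ^+ 2.
  by move=> bp bq s _; rewrite normrM -exprMn expr2 ler_pM.
rewrite -kernel_bilinear -RintegralB//; last 2 first.
- apply: (integrable_kernel alpha_ge alpha_lt delta_gt0 (C := L ^+ 2)); last exact: bound2.
  exact: measurable_funM.
- apply: (integrable_kernel alpha_ge alpha_lt delta_gt0 (C := L ^+ 2)); last exact: bound2.
  exact: measurable_funM.
under eq_Rintegral do rewrite -mulrBl.
have -> : 12 * L * M * delta = 6 * (2 * L * M * delta) by ring.
apply: kernel_bound => // [|s Bs].
  by apply: measurable_funB; exact: measurable_funM.
have -> : U s * V s - dot3 g s * dot3 k s
    = U s * (V s - dot3 k s) + (U s - dot3 g s) * dot3 k s by ring.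
apply: le_trans (ler_normD _ _) _; rewrite !normrM.
have := ler_pM (normr_ge0 _) (normr_ge0 _) (bU s) (dV s Bs).
have := ler_pM (normr_ge0 _) (normr_ge0 _) (dU s Bs) (bk s).
have e0 := enorm3_ge0 s; have sd : enorm3 s <= delta by exact: ltW.
have : (L * enorm3 s) * (M * enorm3 s ^+ 2) <= L * delta * (M * enorm3 s ^+ 2).
  by apply: ler_wpM2r; rewrite ?ler_wpM2l//; apply: mulr_ge0 => //; exact: sqr_ge0.
lra.
Qed.

End kernel_bilinear.

(** * One-dimensional hat functions *)

Section hat_functions.
Context (R : realType) (a h : R).
Hypothesis h_gt0 : 0 < h.
Local Notation mu := (@lebesgue_measure R).
Implicit Types (x y c d : R) (k n : nat).
Local Notation xi := (grid_point a h).

Lemma grid_pointS n : xi n.+1 = xi n + h.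
Proof. by rewrite /grid_point -natr1; ring. Qed.

Lemma grid_point_le m n : (m <= n)%N -> xi m <= xi n.
Proof. by move=> mn; rewrite /grid_point lerD2l ler_pM2r// ler_nat. Qed.

Definition cell k : set (measurableTypeR R) := `]xi k, xi k.+1]%classic.

Lemma measurable_cell k : measurable (cell k).
Proof. exact: measurable_itv. Qed.

Lemma indic_cell k x : \1_(cell k) x = (xi k < x <= xi k + h)%R%:R :> R.
Proof.
rewrite indicE; congr (nat_of_bool _)%:R; rewrite -grid_pointS.
by apply/idP/idP => [/set_mem|H]; [|apply/mem_set]; rewrite /cell/= in_itv.
Qed.

(** In the local coordinate (x - xi k) / h, both a hat function and its
    derivative are sums of two such pieces on adjacent cells. Half-open cells
    make distinct pieces disjoint everywhere. *)
Definition cell_affine k c d x : R := \1_(cell k) x * (c + d * ((x - xi k) / h)).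

(** The derivative of the hat function off the grid; the values at grid points
    are a convention on a null set. *)
Definition dhat n x : R :=
  cell_affine n.-1 h^-1 0 x + cell_affine n (- h^-1) 0 x.

(** On the two cells of the support the equations are multiplied by h, so that
    case analyses leave goals linear in x and h. *)
Variant hat_spec n x (v d : R) : Prop :=
| HatLeft of x <= xi n & v = 0 & d = 0
| HatUp of xi n < x <= xi n + h & h * v = x - xi n & h * d = 1
| HatDown of xi n + h < x <= xi n + 2 * h & h * v = xi n + 2 * h - x & h * d = -1
| HatRight of xi n + 2 * h < x & v = 0 & d = 0.

Lemma hatP n x : hat_spec n x (hat a h n.+1 x) (dhat n.+1 x).
Proof.
have hn0 : h != 0 by rewrite gt_eqF.
have x0 := h_gt0.
rewrite /hat /dhat /cell_affine !indic_cell/= !grid_pointS.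
have [xl|xl] /= := leP x (xi n).
  have -> : (xi n + h < x) = false by apply/negbTE; rewrite -leNgt; lra.
  by rewrite /=; apply: HatLeft => //; ring.
have [xm|xm] /= := leP x (xi n + h).
  by apply: HatUp; rewrite ?xl ?xm//; field.
have [xr|xr] /= := leP x (xi n + h + h).
  apply: HatDown; first by rewrite xm/=; lra.
    have [xr'|xr'] := ltP x (xi n + h + h); first by field.
    have -> : x = xi n + h + h by apply/eqP; rewrite eq_le xr xr'.
    by ring.
  by field.
have -> : (x < xi n + h + h) = false by apply/negbTE; rewrite -leNgt; lra.
apply: HatRight => //; last by ring.
by lra.
Qed.

Lemma hatE n x : hat a h n.+1 x = cell_affine n 0 1 x + cell_affine n.+1 1 (-1) x.
Proof.
have hn0 : h != 0 by rewrite gt_eqF.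
have x0 := h_gt0.
apply: (mulfI hn0); rewrite /cell_affine !indic_cell grid_pointS.
case: (hatP n x) => [xl -> _|/andP[xl xm] -> _|/andP[xm xr] -> _|xr -> _].
- rewrite (_ : xi n < x = false); last by apply/negbTE; rewrite -leNgt; lra.
  rewrite (_ : xi n + h < x = false); last by apply/negbTE; rewrite -leNgt; lra.
  by rewrite /=; ring.
- rewrite xl xm (_ : xi n + h < x = false); last by apply/negbTE; rewrite -leNgt; lra.
  by rewrite /=; field.
- rewrite xm (_ : x <= xi n + h = false); last by apply/negbTE; rewrite -ltNge; lra.
  rewrite (_ : x <= xi n + h + h); last by lra.
  by rewrite andbF/=; field.
- rewrite (_ : x <= xi n + h = false); last by apply/negbTE; rewrite -ltNge; lra.
  rewrite (_ : x <= xi n + h + h = false); last by apply/negbTE; rewrite -ltNge; lra.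
  by rewrite !andbF/=; ring.
Qed.

Lemma hat_ge0 n x : 0 <= hat a h n.+1 x.
Proof.
have x0 := h_gt0; rewrite -(pmulr_rge0 _ h_gt0).
by case: (hatP n x) => [_ -> _|/andP[? ?] -> _|/andP[? ?] -> _|_ -> _]; rewrite ?mulr0//; lra.
Qed.

Lemma hat_le1 n x : hat a h n.+1 x <= 1.
Proof.
have x0 := h_gt0; rewrite -(ler_pM2l h_gt0).
by case: (hatP n x) => [_ -> _|/andP[? ?] -> _|/andP[? ?] -> _|_ -> _]; rewrite ?mulr0//; lra.
Qed.

Lemma hat_lipschitz n x y : `|hat a h n.+1 x - hat a h n.+1 y| <= h^-1 * `|x - y|.
Proof.
have x0 := h_gt0.
wlog xy : x y / x <= y.
  move=> H; case/orP: (le_total x y) => [|/H]; first exact: H.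
  by rewrite distrC (distrC x).
rewrite -(ler_pM2l h_gt0) mulrA mulfV ?gt_eqF// mul1r -{1}(gtr0_norm h_gt0) -normrM.
rewrite (distrC x) (ger0_norm (_ : 0 <= y - x)) ?subr_ge0// mulrBr ler_norml.
by case: (hatP n x) => [? -> _|/andP[? ?] -> _|/andP[? ?] -> _|? -> _];
  case: (hatP n y) => [? -> _|/andP[? ?] -> _|/andP[? ?] -> _|? -> _];
  rewrite ?mulr0; apply/andP; split; lra.
Qed.

Lemma dhat_bound n x : `|dhat n.+1 x| <= h^-1.
Proof.
have x0 := h_gt0; have hn0 : h != 0 by rewrite gt_eqF.
rewrite -(ler_pM2l h_gt0) mulfV// -{1}(gtr0_norm h_gt0) -normrM.
by case: (hatP n x) => [_ _ ->|_ _ ->|_ _ ->|_ _ ->]; rewrite ?mulr0 ?normr0 ?normrN ?normr1.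
Qed.

(** Off the grid, x lies in the interior of one of the four regions on which
    the hat function is affine. *)
Lemma hat_affine_near n x : (forall k, x != xi k) ->
  exists2 e, 0 < e & forall s, `|s| < e ->
    hat a h n.+1 (x + s) = hat a h n.+1 x + dhat n.+1 x * s.
Proof.
have x0 := h_gt0; have hn0 : h != 0 by rewrite gt_eqF.
move=> xk; have := xk n; have := xk n.+1; have := xk n.+2.
rewrite !grid_pointS => n2 n1 n0.
have red s v w d : h * v = h * w + h * d * s -> v = w + d * s.
  by move=> e; apply: (mulfI hn0); rewrite e; ring.
case: (hatP n x) => [xl -> ->|/andP[xl xm] vx dx|/andP[xm xr] vx dx|xr -> ->].
- exists (xi n - x) => [|s]; first by rewrite subr_gt0 lt_neqAle n0.
  rewrite ltr_norml => /andP[s1 s2].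
  by case: (hatP n (x + s)) => [_ -> _|/andP[? ?] _ _|/andP[? ?] _ _|? _ _]; lra.
- exists (Num.min (x - xi n) (xi n + h - x)) => [|s].
    by rewrite lt_min !subr_gt0 xl lt_neqAle n1.
  rewrite lt_min !ltr_norml => /andP[/andP[s1 s2] /andP[s3 s4]].
  apply: red; rewrite vx dx.
  by case: (hatP n (x + s)) => [? _ _|/andP[? ?] -> _|/andP[? ?] _ _|? _ _]; lra.
- exists (Num.min (x - (xi n + h)) (xi n + h + h - x)) => [|s].
    by rewrite lt_min !subr_gt0 xm lt_neqAle n2; lra.
  rewrite lt_min !ltr_norml => /andP[/andP[s1 s2] /andP[s3 s4]].
  apply: red; rewrite vx dx.
  by case: (hatP n (x + s)) => [? _ _|/andP[? ?] _ _|/andP[? ?] -> _|? _ _]; lra.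
- exists (x - (xi n + 2 * h)) => [|s]; first by rewrite subr_gt0.
  rewrite ltr_norml => /andP[s1 s2].
  by case: (hatP n (x + s)) => [? _ _|/andP[? ?] _ _|/andP[? ?] _ _|_ -> _]; lra.
Qed.

Lemma hat_support n x : ~~ (xi n < x <= xi n.+2) ->
  hat a h n.+1 x = 0 /\ dhat n.+1 x = 0.
Proof.
have x0 := h_gt0; rewrite !grid_pointS negb_and -leNgt -ltNge => /orP H.
by case: (hatP n x) => [? -> ->|/andP[? ?] _ _|/andP[? ?] _ _|? -> ->] //;
  case: H => ?; lra.
Qed.

Lemma measurable_cell_affine k c d :
  measurable_fun [set: measurableTypeR R] (cell_affine k c d).
Proof.
apply: measurable_funM; first by apply: measurable_indic; exact: measurable_cell.
apply: measurable_funD => //; apply: measurable_funM => //.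
by apply: measurable_funM => //; apply: measurable_funB.
Qed.

Lemma cell_affine_bound k c d x : `|cell_affine k c d x| <= (`|c| + `|d|) * \1_(cell k) x.
Proof.
rewrite /cell_affine indic_cell; case: (boolP (_ < _ <= _)) => [/andP[h1 h2]|_]; last first.
  by rewrite mul0r mulr0 normr0.
rewrite mul1r mulr1; apply: le_trans (ler_normD _ _) _; rewrite lerD2l normrM.
have q0 : 0 <= (x - xi k) / h by rewrite divr_ge0 ?subr_ge0// ltW.
by rewrite ler_piMr// ger0_norm// ler_pdivrMr// mul1r lerBlDl.
Qed.

Lemma integrable_cell_affineM k l c d c' d' :
  mu.-integrable setT (fun x => (cell_affine k c d x * cell_affine l c' d' x)%:E).
Proof.
apply: (@le_integrable _ _ _ mu setT measurableT _
  (fun x => (((`|c| + `|d|) * (`|c'| + `|d'|))%:E * (\1_(cell k) x)%:E)%E)).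
- by apply/measurable_EFinP; apply: measurable_funM; exact: measurable_cell_affine.
- move=> x _; rewrite -EFinM/= lee_fin normrM.
  apply: le_trans (ler_pM _ _ (cell_affine_bound _ _ _ _) (cell_affine_bound _ _ _ _)) _ => //.
  apply: le_trans (ler_norm _).
  rewrite mulrACA; apply: ler_wpM2l; first by rewrite mulr_ge0 ?addr_ge0.
  by rewrite !indicE; case: (_ \in _); case: (_ \in _); rewrite ?mulr1 ?mulr0.
- by apply: integrableZl => //; exact: integrable_indic_itv.
Qed.

(** Pieces on different cells have disjoint supports; on a common cell the
    product is a quadratic polynomial in the local coordinate. *)
Lemma integral_cell_affineM k l c d c' d' :
  \int[mu]_x (cell_affine k c d x * cell_affine l c' d' x)
  = (k == l)%:R * (h * (c * c' + (c * d' + d * c') / 2 + d * d' / 3)).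
Proof.
have x0 := h_gt0; have hn0 : h != 0 by rewrite gt_eqF.
have [<-{l}|kl] := eqVneq k l; last first.
  rewrite mul0r /Rintegral integral0_eq// => x _.
  rewrite /cell_affine !indic_cell.
  case: (boolP (xi k < x <= _)) => [/andP[h1 h2]|_]; last by rewrite !mul0r.
  case: (boolP (xi l < x <= _)) => [/andP[h3 h4]|_]; last by rewrite mul0r mulr0.
  exfalso; move: kl; rewrite neq_ltn => /orP[/grid_point_le|/grid_point_le];
    rewrite grid_pointS; lra.
rewrite mul1r.
pose G x : R := h * (c * c' * ((x - xi k) / h) + (c * d' + d * c') / 2 * ((x - xi k) / h) ^+ 2
  + d * d' / 3 * ((x - xi k) / h) ^+ 3).
pose g x : R := (c + d * ((x - xi k) / h)) * (c' + d' * ((x - xi k) / h)).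
have dG x : is_derive x 1 G (g x).
  by apply: is_derive_eq; rewrite /g /GRing.scale/=; field.
have cg : continuous g.
  have cl e e' : continuous (fun x => e + e' * ((x - xi k) / h)).
    move=> x; apply: cvgD; first exact: cvg_cst.
    apply: cvgM; first exact: cvg_cst.
    by apply: cvgM; [apply: cvgB; [exact: cvg_id|exact: cvg_cst]|exact: cvg_cst].
  by move=> x; apply: cvgM; exact: cl.
rewrite /Rintegral.
rewrite (_ : integral _ _ _ = \int[mu]_(x in `[xi k, xi k.+1]) (g x)%:E)%E; last first.
  rewrite -integral_itv_obnd_cbnd; last first.
    by apply/measurable_EFinP; apply: measurable_funTS; exact: continuous_measurable_fun.
  rewrite [RHS]integral_mkcond; apply: eq_integral => x _; rewrite patchE.
  rewrite /cell_affine indicE /cell; case: ifP => _; rewrite /g ?mul0r//.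
  by rewrite !mul1r.
rewrite (FTC_primitive (F := G)) //; first last.
- by move=> x _; exact: cg.
- by rewrite grid_pointS ltrDl.
by rewrite /= /G grid_pointS; field.
Qed.

End hat_functions.

(** * Entries of the one-dimensional finite element matrices and tensor integrals *)

Section fem_entries.
Context (R : realType) (a h : R).
Hypothesis h_gt0 : 0 < h.
Local Notation mu := (@lebesgue_measure R).

Definition cell_pair n (c d c' d' x : R) : R :=
  cell_affine a h n c d x + cell_affine a h n.+1 c' d' x.

Lemma integral_cell_pairM n m (c d c' d' e f e' f' : R) :
  let q c d e f : R := h * (c * e + (c * f + d * e) / 2 + d * f / 3) in
  mu.-integrable setT
    (fun x => (cell_pair n c d c' d' x * cell_pair m e f e' f' x)%:E) /\
  \int[mu]_x (cell_pair n c d c' d' x * cell_pair m e f e' f' x)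
  = (n == m)%:R * (q c d e f + q c' d' e' f')
    + (n == m.+1)%:R * q c d e' f' + (m == n.+1)%:R * q c' d' e f.
Proof.
move=> q.
have i1 := integrable_cell_affineM a h_gt0 n m c d e f.
have i2 := integrable_cell_affineM a h_gt0 n m.+1 c d e' f'.
have i3 := integrable_cell_affineM a h_gt0 n.+1 m c' d' e f.
have i4 := integrable_cell_affineM a h_gt0 n.+1 m.+1 c' d' e' f'.
have i12 := integrableD measurableT i1 i2.
have i34 := integrableD measurableT i3 i4.
split.
  have := integrableD measurableT i12 i34; apply: eq_integrable => // x _.
  by rewrite /= -!EFinD /cell_pair; congr EFin; ring.
transitivity (\int[mu]_x ((cell_affine a h n c d x * cell_affine a h m e f x
    + cell_affine a h n c d x * cell_affine a h m.+1 e' f' x)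
  + (cell_affine a h n.+1 c' d' x * cell_affine a h m e f x
    + cell_affine a h n.+1 c' d' x * cell_affine a h m.+1 e' f' x))).
  by apply: eq_Rintegral => x _; rewrite /cell_pair; ring.
rewrite RintegralD// (RintegralD _ i1 i2)// (RintegralD _ i3 i4)//.
rewrite !integral_cell_affineM// eqSS (eq_sym n.+1) /q; ring.
Qed.

Lemma fem_mass_integral N (i j : 'I_N) :
  mu.-integrable setT (fun x => (hat a h i.+1 x * hat a h j.+1 x)%:E) /\
  \int[mu]_x (hat a h i.+1 x * hat a h j.+1 x) = fem_mass h N i j.
Proof.
have [ip E] := integral_cell_pairM i j 0 1 1 (-1) 0 1 1 (-1).
have eqf : (fun x => hat a h i.+1 x * hat a h j.+1 x)
    = (fun x => cell_pair i 0 1 1 (-1) x * cell_pair j 0 1 1 (-1) x).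
  by apply/funext => x; rewrite !hatE.
split; first by move: ip; apply: eq_integrable => // x _; rewrite (congr1 (fun f => f x) eqf).
rewrite eqf E !mxE (_ : (i == j :> nat) = (i == j))//.
have [->|_] := eqVneq i j.
  by rewrite (ltn_eqF (ltnSn j))/=; field.
have [ij|_] := eqVneq (i : nat) j.+1.
  rewrite ij (_ : (j == j.+2 :> nat) = false); first by rewrite /=; field.
  by rewrite ltn_eqF.
by case: eqP => _ /=; field.
Qed.

Lemma fem_stiffness_integral N (i j : 'I_N) :
  mu.-integrable setT (fun x => (dhat a h i.+1 x * dhat a h j.+1 x)%:E) /\
  \int[mu]_x (dhat a h i.+1 x * dhat a h j.+1 x) = fem_stiffness h N i j.
Proof.
have hn0 : h != 0 by rewrite gt_eqF.
have [ip E] := integral_cell_pairM i j h^-1 0 (- h^-1) 0 h^-1 0 (- h^-1) 0.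
split => //; rewrite E !mxE (_ : (i == j :> nat) = (i == j))//.
have [->|_] := eqVneq i j.
  by rewrite (ltn_eqF (ltnSn j))/=; field.
have [ij|_] := eqVneq (i : nat) j.+1.
  rewrite ij (_ : (j == j.+2 :> nat) = false); first by rewrite /=; field.
  by rewrite ltn_eqF.
by case: eqP => _ /=; field.
Qed.

End fem_entries.

Section product_integral.

(** Tonelli on absolute values gives integrability; Fubini then gives the
    value. *)
Lemma integral_tensor d1 d2 (T1 : measurableType d1) (T2 : measurableType d2)
    (R : realType) (m1 : {sigma_finite_measure set T1 -> \bar R})
    (m2 : {sigma_finite_measure set T2 -> \bar R}) (f : T1 -> R) (g : T2 -> R) :
  m1.-integrable setT (EFin \o f) -> m2.-integrable setT (EFin \o g) ->
  (m1 \x m2)%E.-integrable setT (fun p => (f p.1 * g p.2)%:E) /\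
  \int[(m1 \x m2)%E]_p (f p.1 * g p.2) = (\int[m1]_x f x) * (\int[m2]_y g y).
Proof.
move=> intf intg.
have mf : measurable_fun setT f by apply/measurable_EFinP; exact: measurable_int intf.
have mg : measurable_fun setT g by apply/measurable_EFinP; exact: measurable_int intg.
have mfg : measurable_fun setT (fun p : T1 * T2 => (f p.1 * g p.2)%:E).
  apply/measurable_EFinP; apply: measurable_funM.
    by apply: (measurableT_comp mf); exact: measurable_fst.
  by apply: (measurableT_comp mg); exact: measurable_snd.
have fng : (\int[m2]_y (g y)%:E)%E \is a fin_num by exact: integrable_fin_num.
have fnf : (\int[m1]_y (f y)%:E)%E \is a fin_num by exact: integrable_fin_num.
have ifg : (m1 \x m2)%E.-integrable setT (fun p => (f p.1 * g p.2)%:E).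
  apply/(integrable12ltyP m1 m2 mfg).
  have /integrableP[_ fy] := intf; have /integrableP[_ gy] := intg.
  have gf : (\int[m2]_y `|(g y)%:E|)%E \is a fin_num by rewrite ge0_fin_numE// integral_ge0.
  rewrite (_ : integral _ _ _ =
    (\int[m1]_x (`|(f x)%:E| * (fine (\int[m2]_y `|(g y)%:E|))%:E))%E); last first.
    apply: eq_integral => x _; rewrite fineK//.
    rewrite -ge0_integralZl//; last by apply: measurableT_comp => //; exact/measurable_EFinP.
    by apply: eq_integral => y _; rewrite /= normrM EFinM.
  rewrite ge0_integralZr//; first last.
  - by apply: fine_ge0; exact: integral_ge0.
  - by apply: measurableT_comp => //; exact/measurable_EFinP.
  by rewrite lte_mul_pinfty ?fineK ?integral_ge0// ge0_fin_numE// integral_ge0.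
split => //; rewrite /Rintegral -(integral12_prod_meas1 ifg) -fineM//; congr fine.
rewrite -(fineK fng) -integralZr//.
apply: eq_integral => x _; rewrite fineK// /fubini_F.
by rewrite -integralZl//; apply: eq_integral => y _; rewrite EFinM.
Qed.

Lemma integral3_tensor (R : realType) (f g k : R -> R) :
  (@lebesgue_measure R).-integrable setT (EFin \o f) ->
  (@lebesgue_measure R).-integrable setT (EFin \o g) ->
  (@lebesgue_measure R).-integrable setT (EFin \o k) ->
  (@lebesgue3 R).-integrable setT (fun x => (f x.1.1 * g x.1.2 * k x.2)%:E) /\
  \int[@lebesgue3 R]_x (f x.1.1 * g x.1.2 * k x.2)
  = (\int[@lebesgue_measure R]_x f x) * (\int[@lebesgue_measure R]_x g x)
    * (\int[@lebesgue_measure R]_x k x).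
Proof.
move=> intf intg intk.
have [i2 E2] := integral_tensor intf intg.
have [i3 E3] := integral_tensor (m1 := @lebesgue2 R) i2 intk.
by split; [exact: i3|rewrite -E2; exact: E3].
Qed.

End product_integral.

(** * Increments of the tensor-product basis functions *)

Section three_factors.
Context (R : realDomainType).

Lemma abs_mulr_le1 (x y c : R) : `|x| <= c -> 0 <= y <= 1 -> `|x * y| <= c.
Proof.
move=> xc /andP[y0 y1]; rewrite normrM (ger0_norm y0).
by apply: le_trans xc; rewrite ler_piMr.
Qed.

(** The difference telescopes into three products in which all factors but one
    lie in the unit interval. *)
Lemma prod3_lipschitz (F1 F2 F3 f1 f2 f3 c : R) :
  0 <= F2 <= 1 -> 0 <= F3 <= 1 -> 0 <= f1 <= 1 -> 0 <= f2 <= 1 ->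
  `|F1 - f1| <= c -> `|F2 - f2| <= c -> `|F3 - f3| <= c ->
  `|F1 * F2 * F3 - f1 * f2 * f3| <= 3 * c.
Proof.
move=> HF2 HF3 Hf1 Hf2 H1 H2 H3.
have -> : F1 * F2 * F3 - f1 * f2 * f3 =
  (F1 - f1) * F2 * F3 + (F2 - f2) * F3 * f1 + (F3 - f3) * f1 * f2 by ring.
have K1 : `|(F1 - f1) * F2 * F3| <= c by do 2!apply: abs_mulr_le1 => //.
have K2 : `|(F2 - f2) * F3 * f1| <= c by do 2!apply: abs_mulr_le1 => //.
have K3 : `|(F3 - f3) * f1 * f2| <= c by do 2!apply: abs_mulr_le1 => //.
apply: le_trans (ler_normD _ _) _; have := ler_normD ((F1 - f1) * F2 * F3) ((F2 - f2) * F3 * f1).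
lra.
Qed.

(** After removing the terms linear in e1, e2, e3, the remainder is the sum of
    e1 e2 F3, e1 e3 f2 and e2 e3 f1. *)
Lemma prod3_affine (F1 F2 F3 f1 f2 f3 e1 e2 e3 c : R) :
  0 <= F3 <= 1 -> 0 <= f1 <= 1 -> 0 <= f2 <= 1 ->
  F1 = f1 + e1 -> F2 = f2 + e2 -> F3 = f3 + e3 ->
  `|e1| <= c -> `|e2| <= c -> `|e3| <= c ->
  `|F1 * F2 * F3 - f1 * f2 * f3 - (e1 * f2 * f3 + f1 * e2 * f3 + f1 * f2 * e3)|
    <= 3 * c ^+ 2.
Proof.
move=> HF3 Hf1 Hf2 E1 E2 E3 H1 H2 H3.
have -> : F1 * F2 * F3 - f1 * f2 * f3 - (e1 * f2 * f3 + f1 * e2 * f3 + f1 * f2 * e3)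
  = e1 * e2 * F3 + e1 * e3 * f2 + e2 * e3 * f1 by rewrite E1 E2 E3; ring.
have K x y : `|x| <= c -> `|y| <= c -> `|x * y| <= c ^+ 2.
  by move=> ? ?; rewrite normrM expr2 ler_pM.
have K1 : `|e1 * e2 * F3| <= c ^+ 2 by apply: abs_mulr_le1 => //; exact: K.
have K2 : `|e1 * e3 * f2| <= c ^+ 2 by apply: abs_mulr_le1 => //; exact: K.
have K3 : `|e2 * e3 * f1| <= c ^+ 2 by apply: abs_mulr_le1 => //; exact: K.
apply: le_trans (ler_normD _ _) _; have := ler_normD (e1 * e2 * F3) (e1 * e3 * f2).
lra.
Qed.

Lemma prod3_differential (f1 f2 f3 e1 e2 e3 c : R) :
  0 <= f1 <= 1 -> 0 <= f2 <= 1 -> 0 <= f3 <= 1 ->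
  `|e1| <= c -> `|e2| <= c -> `|e3| <= c ->
  `|e1 * f2 * f3 + f1 * e2 * f3 + f1 * f2 * e3| <= 3 * c.
Proof.
move=> Hf1 Hf2 Hf3 H1 H2 H3.
rewrite (mulrC f1 e2) (mulrC (f1 * f2)) [e3 * _]mulrA.
have K1 : `|e1 * f2 * f3| <= c by do 2!apply: abs_mulr_le1 => //.
have K2 : `|e2 * f1 * f3| <= c by do 2!apply: abs_mulr_le1 => //.
have K3 : `|e3 * f1 * f2| <= c by do 2!apply: abs_mulr_le1 => //.
apply: le_trans (ler_normD _ _) _; have := ler_normD (e1 * f2 * f3) (e2 * f1 * f3).
lra.
Qed.

End three_factors.

Section tensor_hat.
Context (R : realType) (a1 a2 a3 h : R).
Hypothesis h_gt0 : 0 < h.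
Local Notation T3 := (measurableTypeR R * measurableTypeR R * measurableTypeR R)%type.
Implicit Types (n : nat * nat * nat) (x s : R * R * R).

(** Grid indices count from 0, hence the shifts by one. *)
Definition node_fun n x : R := hat3 a1 a2 a3 h n.1.1.+1 n.1.2.+1 n.2.+1 x.

(** The gradient of [node_fun] off the grid planes. *)
Definition node_grad n x : R * R * R :=
  ((dhat a1 h n.1.1.+1 x.1.1 * hat a2 h n.1.2.+1 x.1.2 * hat a3 h n.2.+1 x.2,
    hat a1 h n.1.1.+1 x.1.1 * dhat a2 h n.1.2.+1 x.1.2 * hat a3 h n.2.+1 x.2),
    hat a1 h n.1.1.+1 x.1.1 * hat a2 h n.1.2.+1 x.1.2 * dhat a3 h n.2.+1 x.2).

Let hat01 a i y : 0 <= hat a h i.+1 y <= 1.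
Proof. by rewrite hat_ge0//= hat_le1. Qed.

Lemma node_fun_lipschitz n x s :
  `|node_fun n (x + s) - node_fun n x| <= 3 * h^-1 * enorm3 s.
Proof.
have [s1 s2 s3] := abs_coord_le s.
have lip a i y t : `|t| <= enorm3 s ->
    `|hat a h i.+1 (y + t) - hat a h i.+1 y| <= h^-1 * enorm3 s.
  move=> te; apply: le_trans (hat_lipschitz _ h_gt0 _ _ _) _.
  by rewrite addrC addKr ler_pM2l ?invr_gt0.
by rewrite -[leRHS]mulrA; apply: prod3_lipschitz; rewrite ?hat01//; exact: lip.
Qed.

Lemma dot3_node_grad n x s : dot3 (node_grad n x) s =
  dhat a1 h n.1.1.+1 x.1.1 * s.1.1 * hat a2 h n.1.2.+1 x.1.2 * hat a3 h n.2.+1 x.2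
  + hat a1 h n.1.1.+1 x.1.1 * (dhat a2 h n.1.2.+1 x.1.2 * s.1.2) * hat a3 h n.2.+1 x.2
  + hat a1 h n.1.1.+1 x.1.1 * hat a2 h n.1.2.+1 x.1.2 * (dhat a3 h n.2.+1 x.2 * s.2).
Proof. by rewrite /dot3 /node_grad/=; ring. Qed.

Let dhat_le a i (y t e : R) : `|t| <= e -> `|dhat a h i.+1 y * t| <= h^-1 * e.
Proof. by move=> te; rewrite normrM ler_pM// dhat_bound. Qed.

Lemma dot3_node_grad_le n x s :
  `|dot3 (node_grad n x) s| <= 3 * h^-1 * enorm3 s.
Proof.
have [s1 s2 s3] := abs_coord_le s.
rewrite dot3_node_grad -[leRHS]mulrA.
by apply: prod3_differential; rewrite ?hat01//; exact: dhat_le.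
Qed.

Lemma node_fun_affine_near n x :
  (forall k, x.1.1 != grid_point a1 h k) -> (forall k, x.1.2 != grid_point a2 h k) ->
  (forall k, x.2 != grid_point a3 h k) ->
  exists2 e, 0 < e & forall s, enorm3 s < e ->
    `|node_fun n (x + s) - node_fun n x - dot3 (node_grad n x) s|
      <= 3 * h^-1 ^+ 2 * enorm3 s ^+ 2.
Proof.
move=> x1 x2 x3.
have [e1 e10 H1] := hat_affine_near h_gt0 n.1.1 x1.
have [e2 e20 H2] := hat_affine_near h_gt0 n.1.2 x2.
have [e3 e30 H3] := hat_affine_near h_gt0 n.2 x3.
exists (Num.min e1 (Num.min e2 e3)) => [|s]; first by rewrite !lt_min e10 e20.
rewrite !lt_min => /and3P[se1 se2 se3].
have [s1 s2 s3] := abs_coord_le s.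
rewrite dot3_node_grad -[leRHS]mulrA -exprMn.
apply: prod3_affine; rewrite ?hat01//; do ?exact: dhat_le.
- by apply: H1; exact: le_lt_trans se1.
- by apply: H2; exact: le_lt_trans se2.
- by apply: H3; exact: le_lt_trans se3.
Qed.

Lemma measurable_hat a i : measurable_fun [set: measurableTypeR R] (hat a h i.+1).
Proof.
rewrite (_ : hat a h i.+1 =
  (fun y => cell_affine a h i 0 1 y + cell_affine a h i.+1 1 (-1) y)); last first.
  by apply/funext => y; rewrite hatE.
by apply: measurable_funD; exact: measurable_cell_affine.
Qed.

Lemma measurable_node_fun n : measurable_fun [set: T3] (node_fun n).
Proof.
apply: measurable_funM; last first.
  by apply: (measurableT_comp (measurable_hat _ _)); exact: measurable_coord3.
apply: measurable_funM; apply: (measurableT_comp (measurable_hat _ _)).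
  exact: measurable_coord1.
exact: measurable_coord2.
Qed.

Lemma measurable_add3 :
  measurable_fun [set: T3 * T3] (fun p => (p.1 : R * R * R) + p.2 : T3).
Proof.
have c1 : measurable_fun [set: T3 * T3] (fun p => p.1.1.1 + p.2.1.1 : R).
  apply: measurable_funD; apply: (measurableT_comp (@measurable_coord1 R)).
    exact: measurable_fst.
  exact: measurable_snd.
have c2 : measurable_fun [set: T3 * T3] (fun p => p.1.1.2 + p.2.1.2 : R).
  apply: measurable_funD; apply: (measurableT_comp (@measurable_coord2 R)).
    exact: measurable_fst.
  exact: measurable_snd.
have c3 : measurable_fun [set: T3 * T3] (fun p => p.1.2 + p.2.2 : R).
  apply: measurable_funD; apply: (measurableT_comp (@measurable_coord3 R)).
    exact: measurable_fst.
  exact: measurable_snd.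
by apply: measurable_fun_pair => //; apply: measurable_fun_pair.
Qed.

End tensor_hat.

(** * The inner integral and its pointwise limit *)

Section null_grid.
Context (R : realType).
Local Notation mu := (@lebesgue_measure R).
Local Notation T3 := (measurableTypeR R * measurableTypeR R * measurableTypeR R)%type.

Lemma lebesgue3_box (A1 A2 A3 : set (measurableTypeR R)) :
  measurable A1 -> measurable A2 -> measurable A3 ->
  @lebesgue3 R (A1 `*` A2 `*` A3) = (mu A1 * mu A2 * mu A3)%E.
Proof.
move=> m1 m2 m3; have m12 : measurable (A1 `*` A2) by exact: measurableX.
rewrite /lebesgue3 (product_measure1E (@lebesgue2 R))//; congr (_ * _)%E.
by rewrite -(product_measure1E mu).
Qed.

Lemma negligible_slabs (F1 F2 F3 : set (measurableTypeR R)) :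
  countable F1 -> countable F2 -> countable F3 ->
  (@lebesgue3 R).-negligible
    [set x : T3 | [\/ F1 x.1.1, F2 x.1.2 | F3 x.2]].
Proof.
move=> c1 c2 c3.
have mC (F : set (measurableTypeR R)) : countable F -> measurable F.
  by apply: countable_measurable; exact: measurable_set1.
have [m1 m2 m3] : [/\ measurable F1, measurable F2 & measurable F3].
  by split; exact: mC.
have mT : measurable [set: measurableTypeR R] by exact: measurableT.
have N1 : (@lebesgue3 R).-negligible (F1 `*` setT `*` setT).
  apply/negligibleP; first by do 2!apply: measurableX => //.
  apply: etrans (lebesgue3_box m1 mT mT) _.
  by rewrite (countable_lebesgue_measure0 c1) !mul0e.
have N2 : (@lebesgue3 R).-negligible (setT `*` F2 `*` setT).
  apply/negligibleP; first by do 2!apply: measurableX => //.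
  apply: etrans (lebesgue3_box mT m2 mT) _.
  by rewrite (countable_lebesgue_measure0 c2) mule0 mul0e.
have N3 : (@lebesgue3 R).-negligible (setT `*` setT `*` F3).
  apply/negligibleP; first by do 2!apply: measurableX => //.
  apply: etrans (lebesgue3_box mT mT m3) _.
  by rewrite (countable_lebesgue_measure0 c3) mule0.
apply: negligibleS (negligibleU N1 (negligibleU N2 N3)).
by move=> x /= [?|?|?]; [left|right; left|right; right]; repeat split.
Qed.

(** The positive and negative parts have measurable partial integrals by
    Tonelli, and [fine] is measurable. *)
Lemma measurable_Rintegral_param (B : set T3) (f : T3 * T3 -> R) :
  measurable B -> measurable_fun setT f ->
  measurable_fun [set: T3] (fun x => \int[@lebesgue3 R]_(s in B) f (x, s)).
Proof.
move=> mB mf; apply: (measurableT_comp (@fine_measurable R setT measurableT)).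
pose g (p : T3 * T3) : \bar R := (f p * \1_B p.2)%:E.
have mg : measurable_fun [set: T3 * T3] g.
  apply/measurable_EFinP; apply: measurable_funM => //.
  have mI : measurable_fun [set: T3] (\1_B : T3 -> R) by exact: measurable_indic.
  by apply: (measurableT_comp mI); exact: measurable_snd.
rewrite (_ : (fun x => _) = (fun x => \int[@lebesgue3 R]_s g^\+ (x, s)
    - \int[@lebesgue3 R]_s g^\- (x, s))%E).
  apply: emeasurable_funB.
    apply: (measurable_fun_fubini_tonelli_F (m2 := @lebesgue3 R) g^\+)%E => //.
    exact: measurable_funepos.
  apply: (measurable_fun_fubini_tonelli_F (m2 := @lebesgue3 R) g^\-)%E => //.
  exact: measurable_funeneg.
apply/funext => x; rewrite integral_mkcond integralE.
congr (_ - _)%E; apply: eq_integral => s _; rewrite ?funeposE ?funenegE patchE /g indicE;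
  by case: (s \in B); rewrite /= ?mulr1 ?mulr0.
Qed.

End null_grid.

Section local_limit.
Context (R : realType) (a1 a2 a3 h alpha : R).
Hypotheses (h_gt0 : 0 < h) (alpha_ge : -1 <= alpha) (alpha_lt : alpha < 2).
Local Notation T3 := (measurableTypeR R * measurableTypeR R * measurableTypeR R)%type.
Local Notation node_fun := (node_fun a1 a2 a3 h).
Local Notation node_grad := (node_grad a1 a2 a3 h).
Implicit Types (delta : R) (n m : nat * nat * nat) (x s : R * R * R).

Definition increment_density delta n m x : R :=
  \int[@lebesgue3 R]_(s in eball3 delta)
    ((node_fun n (x + s) - node_fun n x) * (node_fun m (x + s) - node_fun m x)
     * frac_kernel alpha delta (enorm3 s)).

Definition grad_density n m x : R :=
  (node_grad n x).1.1 * (node_grad m x).1.1 + (node_grad n x).1.2 * (node_grad m x).1.2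
  + (node_grad n x).2 * (node_grad m x).2.

Lemma measurable_increment n :
  measurable_fun [set: T3 * T3] (fun p => node_fun n (p.1 + p.2) - node_fun n p.1).
Proof.
apply: measurable_funB.
  exact: (measurableT_comp (measurable_node_fun _ _ _ _ _) (@measurable_add3 R)).
exact: (measurableT_comp (measurable_node_fun a1 a2 a3 h_gt0 n) measurable_fst).
Qed.

Lemma measurable_increment_at n x :
  measurable_fun [set: T3] (fun s => node_fun n (x + s) - node_fun n x).
Proof.
have mp : measurable_fun [set: T3] (fun s : T3 => ((x : T3), s)).
  by apply: measurable_fun_pair => //; exact: measurable_cst.
exact: (measurableT_comp (measurable_increment n) mp).
Qed.

Lemma measurable_increment_density delta n m :
  measurable_fun [set: T3] (increment_density delta n m).
Proof.
apply: (@measurable_Rintegral_param _ _ (fun p : T3 * T3 =>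
  (node_fun n ((p.1 : R * R * R) + p.2) - node_fun n p.1)
  * (node_fun m ((p.1 : R * R * R) + p.2) - node_fun m p.1)
     * frac_kernel alpha delta (enorm3 p.2))); first exact: measurable_eball3.
apply: measurable_funM.
  by apply: measurable_funM; exact: measurable_increment.
by apply: (measurableT_comp (@measurable_frac_kernel R alpha delta)); exact: measurable_snd.
Qed.

Lemma increment_density_bound delta n m x : 0 < delta ->
  `|increment_density delta n m x| <= 6 * (3 * h^-1) ^+ 2.
Proof.
move=> d0; apply: kernel_bound => // [|s _].
  by apply: measurable_funM; exact: measurable_increment_at.
rewrite normrM -exprMn expr2; apply: ler_pM => //; exact: node_fun_lipschitz.
Qed.

Definition off_grid x : Prop := [/\ forall k, x.1.1 != grid_point a1 h k,
  forall k, x.1.2 != grid_point a2 h k & forall k, x.2 != grid_point a3 h k].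

Lemma increment_density_approx n m x : off_grid x ->
  exists2 e, 0 < e & forall delta, 0 < delta < e ->
    `|increment_density delta n m x - 2 * grad_density n m x|
      <= 12 * (3 * h^-1) * (3 * h^-1 ^+ 2) * delta.
Proof.
move=> [x1 x2 x3].
have [e e0 He] := node_fun_affine_near h_gt0 n x1 x2 x3.
have [f f0 Hf] := node_fun_affine_near h_gt0 m x1 x2 x3.
exists (Num.min e f) => [|delta /andP[d0]]; first by rewrite lt_min e0.
rewrite lt_min => /andP[de df].
apply: kernel_bilinear_approx => //.
- by rewrite mulr_ge0// invr_ge0 ltW.
- by rewrite mulr_ge0// sqr_ge0.
- exact: measurable_increment_at.
- exact: measurable_increment_at.
- by move=> s; exact: node_fun_lipschitz.
- by move=> s; exact: dot3_node_grad_le.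
- by move=> s sd; apply: He; exact: lt_trans de.
- by move=> s sd; apply: Hf; exact: lt_trans df.
- by move=> s; exact: node_fun_lipschitz.
- by move=> s; exact: dot3_node_grad_le.
Qed.

Lemma ae_off_grid : {ae @lebesgue3 R, forall x : T3, off_grid x}.
Proof.
have cF a : countable (range (grid_point a h)) by exact: card_image_le.
apply: negligibleS (negligible_slabs (cF a1) (cF a2) (cF a3)) => x /= xN.
apply: contrapT => H; apply: xN; split => k; apply/eqP => xk; apply: H.
- by apply: Or31; exists k.
- by apply: Or32; exists k.
- by apply: Or33; exists k.
Qed.

End local_limit.

(** * Dominated convergence and the limit matrix *)

Section global_limit.
Context (R : realType) (a1 a2 a3 h alpha : R).
Hypotheses (h_gt0 : 0 < h) (alpha_ge : -1 <= alpha) (alpha_lt : alpha < 2).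
Local Notation T3 := (measurableTypeR R * measurableTypeR R * measurableTypeR R)%type.
Local Notation node_fun := (node_fun a1 a2 a3 h).
Local Notation grad_density := (grad_density a1 a2 a3 h).
Implicit Types (delta : R) (n m : nat * nat * nat).

Lemma integral_grad_density N1 N2 N3 (i1 j1 : 'I_N1) (i2 j2 : 'I_N2) (i3 j3 : 'I_N3) :
  let n := (i1 : nat, i2 : nat, i3 : nat) in let m := (j1 : nat, j2 : nat, j3 : nat) in
  (@lebesgue3 R).-integrable setT (fun x => (grad_density n m x)%:E) /\
  \int[@lebesgue3 R]_x grad_density n m x
  = fem_stiffness h N1 i1 j1 * fem_mass h N2 i2 j2 * fem_mass h N3 i3 j3
  + fem_mass h N1 i1 j1 * fem_stiffness h N2 i2 j2 * fem_mass h N3 i3 j3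
  + fem_mass h N1 i1 j1 * fem_mass h N2 i2 j2 * fem_stiffness h N3 i3 j3.
Proof.
move=> n m.
have [s1 S1] := fem_stiffness_integral a1 h_gt0 i1 j1.
have [s2 S2] := fem_stiffness_integral a2 h_gt0 i2 j2.
have [s3 S3] := fem_stiffness_integral a3 h_gt0 i3 j3.
have [m1 M1] := fem_mass_integral a1 h_gt0 i1 j1.
have [m2 M2] := fem_mass_integral a2 h_gt0 i2 j2.
have [m3 M3] := fem_mass_integral a3 h_gt0 i3 j3.
have [t1 E1] := integral3_tensor s1 m2 m3.
have [t2 E2] := integral3_tensor m1 s2 m3.
have [t3 E3] := integral3_tensor m1 m2 s3.
have t12 := integrableD measurableT t1 t2.
rewrite -S1 -S2 -S3 -M1 -M2 -M3 -E1 -E2 -E3 -(RintegralD _ t1 t2)// -RintegralD//.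
split; last by apply: eq_Rintegral => x _; rewrite /grad_density/=; ring.
move: (integrableD measurableT t12 t3); apply: eq_integrable => // x _.
by rewrite /= -!EFinD /grad_density/=; congr EFin; ring.
Qed.

Lemma measurable_enlarged_box (b1 b2 b3 delta : R) :
  measurable (enlarged_box a1 a2 a3 b1 b2 b3 delta : set T3).
Proof. by apply: measurableX; first apply: measurableX; exact: measurable_itv. Qed.

Lemma integrable_enlarged_box (b1 b2 b3 delta : R) :
  (@lebesgue3 R).-integrable setT
    (fun x : T3 => (\1_(enlarged_box a1 a2 a3 b1 b2 b3 delta : set T3) x : R)%:E).
Proof.
have i1 := integrable_indic_itv (a1 - delta) (b1 + delta) false true.
have i2 := integrable_indic_itv (a2 - delta) (b2 + delta) false true.
have i3 := integrable_indic_itv (a3 - delta) (b3 + delta) false true.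
have [+ _] := integral3_tensor i1 i2 i3; apply: eq_integrable => // x _.
by congr EFin; rewrite !indicE /enlarged_box !in_setX -!natrM !mulnb.
Qed.

Lemma enlarged_boxS (b1 b2 b3 delta delta' : R) : delta <= delta' ->
  enlarged_box a1 a2 a3 b1 b2 b3 delta `<=` enlarged_box a1 a2 a3 b1 b2 b3 delta'.
Proof.
move=> dd'.
have sub (a b : R) : `]a - delta, b + delta[ `<=` `]a - delta', b + delta'[.
  move=> y /=; rewrite !in_itv/= => /andP[ay yb].
  by rewrite (le_lt_trans _ ay) ?(lt_le_trans yb)// ?lerD2l// lerN2.
by move=> x [[/= x1 x2] x3]; split; first split; exact: sub.
Qed.

(** The first basis function is supported in the original box, so that
    restricting the integral to the enlarged box loses nothing. *)
Lemma grad_density_support (b1 b2 b3 delta : R) n m (x : T3) : 0 < delta ->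
  grid_point a1 h n.1.1.+2 <= b1 -> grid_point a2 h n.1.2.+2 <= b2 ->
  grid_point a3 h n.2.+2 <= b3 ->
  ~ enlarged_box a1 a2 a3 b1 b2 b3 delta x -> grad_density n m x = 0.
Proof.
move=> d0 H1 H2 H3 xN.
have out (a b y : R) i : grid_point a h i.+2 <= b -> ~ (y \in `]a - delta, b + delta[) ->
    hat a h i.+1 y = 0 /\ dhat a h i.+1 y = 0.
  move=> ib yN; apply: hat_support => //; apply/negP => /andP[y1 y2]; apply: yN.
  rewrite in_itv/=; have := grid_point_le a h_gt0 (leq0n i).
  by rewrite {1}/grid_point mul0r addr0 => ?; apply/andP; split; lra.
have [x1|x1] := pselect (x.1.1 \in `]a1 - delta, b1 + delta[); last first.
  have [E1 E2] := out _ _ _ _ H1 x1.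
  by rewrite /grad_density/= E1 E2; ring.
have [x2|x2] := pselect (x.1.2 \in `]a2 - delta, b2 + delta[); last first.
  have [E1 E2] := out _ _ _ _ H2 x2.
  by rewrite /grad_density/= E1 E2; ring.
have [x3|x3] := pselect (x.2 \in `]a3 - delta, b3 + delta[); last first.
  have [E1 E2] := out _ _ _ _ H3 x3.
  by rewrite /grad_density/= E1 E2; ring.
by exfalso; apply: xN.
Qed.

(** Along a sequence delta_k -> 0, dominated convergence applies to the inner
    integrals cut off to the enlarged boxes, all contained in the box enlarged
    by a bound M of the sequence. *)
Lemma nonlocal_form_cvg (b1 b2 b3 : R) n m :
  grid_point a1 h n.1.1.+2 <= b1 -> grid_point a2 h n.1.2.+2 <= b2 ->
  grid_point a3 h n.2.+2 <= b3 ->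
  (@lebesgue3 R).-integrable setT (fun x => (grad_density n m x)%:E) ->
  nonlocal_form (enlarged_box a1 a2 a3 b1 b2 b3 delta) delta
      (frac_kernel alpha delta) (node_fun n) (node_fun m) @[delta --> 0^'+]
  --> \int[@lebesgue3 R]_x grad_density n m x.
Proof.
move=> H1 H2 H3 ig; apply/cvg_at_rightP => d [d0 dcvg].
have [M Md] : exists M, forall k, d k <= M.
  have cd : cvgn d by apply/cvg_ex; exists 0.
  have [M [_ HM]] := cvg_seq_bounded cd.
  exists (M + 1) => k; apply: le_trans (ler_norm _) _.
  by apply: HM => //; rewrite ltrDl.
pose box delta : set T3 := enlarged_box a1 a2 a3 b1 b2 b3 delta.
pose J k (x : T3) := increment_density a1 a2 a3 h alpha (d k) n m x.
pose f k (x : T3) : \bar R := ((J k \_ (box (d k))) x)%:E.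
pose C : R := 6 * (3 * h^-1) ^+ 2.
have C0 : 0 <= C by rewrite mulr_ge0// sqr_ge0.
have mbox delta : measurable (box delta) by exact: measurable_enlarged_box.
have i2g : (@lebesgue3 R).-integrable setT (fun x => (2 * grad_density n m x)%:E).
  under eq_fun do rewrite EFinM.
  exact: integrableZl.
have mf k : measurable_fun setT (f k).
  apply/measurable_EFinP/(measurable_restrictT _ (mbox (d k))).
  by apply: measurable_funTS; exact: measurable_increment_density.
have fcvg : {ae @lebesgue3 R, forall x, setT x ->
    f ^~ x @ \oo --> (2 * grad_density n m x)%:E}.
  apply: negligibleS (ae_off_grid a1 a2 a3 h) => x /= ncvg xoff; apply: ncvg => _.
  apply: cvg_EFin; first exact: nearW.
  have [e e0 He] := increment_density_approx h_gt0 alpha_ge alpha_lt n m xoff.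
  pose K := 12 * (3 * h^-1) * (3 * h^-1 ^+ 2).
  have Kd : K * d k @[k --> \oo] --> (0 : R).
    by rewrite -[X in _ --> X](mulr0 K); apply: cvgMr.
  apply/cvgrPdist_le => _ /posnumP[eps].
  near=> k.
  have dke : d k < e by near: k; exact: (cvgr_lt _ dcvg).
  have Kde : K * d k <= eps%:num by near: k; exact: (cvgr_le _ Kd).
  apply: le_trans Kde; rewrite /= /f/= patchE.
  have := He (d k); rewrite d0 dke => /(_ isT) Hk.
  case: ifPn => [_|/negP xN]; first by rewrite distrC.
  rewrite (@grad_density_support b1 b2 b3 (d k)) ?mulr0 ?subrr ?normr0//.
    by rewrite /K !mulr_ge0 ?sqr_ge0 ?invr_ge0 ?(ltW h_gt0) ?ltW.
  by move=> xb; apply: xN; exact/mem_set.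
have fdom : {ae @lebesgue3 R, forall x k, setT x ->
    (`|f k x| <= C%:E * (\1_(box M) x)%:E)%E}.
  apply: aeW => x k _; rewrite /f /= patchE -EFinM lee_fin indicE.
  case: ifPn => [/set_mem xb|_]; last by rewrite normr0 mulr_ge0.
  rewrite mem_set; last exact: enlarged_boxS (Md k) _ xb.
  by rewrite mulr1; exact: increment_density_bound.
have idom : (@lebesgue3 R).-integrable setT (fun x => (C%:E * (\1_(box M) x)%:E)%E).
  by apply: integrableZl => //; exact: integrable_enlarged_box.
have [_ _ lim] := dominated_convergence (@measurableT _ _) mf (measurable_int _ i2g) fcvg idom fdom.
have Rlim : (\int[@lebesgue3 R]_x ((J k \_ (box (d k))) x))%R @[k --> \oo]
    --> \int[@lebesgue3 R]_x (2 * grad_density n m x).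
  by apply: fine_cvg; rewrite fineK//; exact: integrable_fin_num.
rewrite RintegralZl// in Rlim.
rewrite (_ : (fun _ => _) = (fun k => 2^-1 * \int[@lebesgue3 R]_x ((J k \_ (box (d k))) x))).
  rewrite -[X in _ --> X](mulKf (_ : 2 != 0 :> R))//.
  by apply: cvgMr.
by apply/funext => k; rewrite /nonlocal_form -Rintegral_mkcond.
Unshelve. all: end_near. Qed.

End global_limit.

Theorem mainTheorem5 (R : realType) (a1 a2 a3 b1 b2 b3 h : R)
    (N1 N2 N3 : nat) (N1_ge1 : (1 <= N1)%N) (N2_ge1 : (1 <= N2)%N)
    (N3_ge1 : (1 <= N3)%N) (h_gt0 : 0 < h)
    (h_eq1 : h = (b1 - a1) / (N1 + 1)%:R)
    (h_eq2 : h = (b2 - a2) / (N2 + 1)%:R)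
    (h_eq3 : h = (b3 - a3) / (N3 + 1)%:R)
    (alpha : R) (alpha_ge : -1 <= alpha) (alpha_lt : alpha < 2)
    (l l' : 'I_(N3 * N2 * N1)) :
  nonlocal_stiffness a1 a2 a3 b1 b2 b3 h N1 N2 N3 delta
      (frac_kernel alpha delta) l l' @[delta --> 0^'+]
  --> (fem_stiffness h N3 *t fem_mass h N2 *t fem_mass h N1
       + fem_mass h N3 *t fem_stiffness h N2 *t fem_mass h N1
       + fem_mass h N3 *t fem_mass h N2 *t fem_stiffness h N1) l l'.
Proof.
pose i1 := (mxtens_unindex l).2; pose i2 := (mxtens_unindex (mxtens_unindex l).1).2.
pose i3 := (mxtens_unindex (mxtens_unindex l).1).1.
pose j1 := (mxtens_unindex l').2; pose j2 := (mxtens_unindex (mxtens_unindex l').1).2.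
pose j3 := (mxtens_unindex (mxtens_unindex l').1).1.
have [ig Eg] := integral_grad_density a1 a2 a3 h_gt0 i1 j1 i2 j2 i3 j3.
have last_node (a b : R) N (i : 'I_N) : h = (b - a) / (N + 1)%:R -> grid_point a h i.+2 <= b.
  move=> hE; have N0 : (N + 1)%:R != 0 :> R by rewrite addn1 pnatr_eq0.
  have -> : b = grid_point a h (N + 1).
    by rewrite /grid_point {1}hE mulrC divfK// addrC subrK.
  by apply: grid_point_le => //; rewrite addn1 ltnS.
have basisE (k : 'I_(N3 * N2 * N1)) : basis_fun a1 a2 a3 h N1 N2 k
    = node_fun a1 a2 a3 h ((mxtens_unindex k).2 : nat,
        (mxtens_unindex (mxtens_unindex k).1).2 : nat,
        (mxtens_unindex (mxtens_unindex k).1).1 : nat).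
  by rewrite /basis_fun divnMA.
rewrite (_ : (fun _ => _) = (fun delta =>
  nonlocal_form (enlarged_box a1 a2 a3 b1 b2 b3 delta) delta (frac_kernel alpha delta)
    (node_fun a1 a2 a3 h (i1 : nat, i2 : nat, i3 : nat))
    (node_fun a1 a2 a3 h (j1 : nat, j2 : nat, j3 : nat)))); last first.
  by apply/funext => delta; rewrite mxE !basisE.
rewrite [X in _ --> X](_ : _ = \int[@lebesgue3 R]_x
    grad_density a1 a2 a3 h (i1 : nat, i2 : nat, i3 : nat) (j1 : nat, j2 : nat, j3 : nat) x).
  by apply: nonlocal_form_cvg => //; exact: last_node.
by rewrite Eg !mxE; ring.
Qed.
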